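(* Let $\varphi$ be a fixed mapping that, given a finite universe $U$ and a bit-string $s$, yields a set $\varphi(U,s)$ of feasible solutions, each being a pair $F=(Q,s')$ with $Q\subseteq U$ and $s'$ a bit-string. Consider the optimization problem $P_\varphi$: given $(U,s,W,w)$ where $W$ is a positive integer and $w:U\to\{1,\dots,W\}$, find $F=(Q,s')\in\varphi(U,s)$ minimizing $\sum_{e\in Q}w(e)$. Suppose there exists an algorithm $\mathcal{A}$ that, given any instance $(U,s,W,w)$ of $P_\varphi$ and any parameter $\epsilon \in (0,1)$, outputs a feasible solution $F \in \varphi(U,s)$ such that with probability at least $\frac{1}{2}$, $F$ is a $(1+\epsilon)$-approximate solution to the instance $(U,s,W,w)$. Furthermore, suppose that there exists some function $T(\cdot,\cdot)$ such that the running time of $\mathcal{A}$ on any instance $(U,s,W,w)$ and parameter $\epsilon \in (0,1)$ is $O\left(T(s,\epsilon) \cdot \mathrm{polylog}(W)\right)$. Then there exists an algorithm $\mathcal{A}'$ that, given the same input as $\mathcal{A}$, runs in time $O\left((T(s,\epsilon)+|U|) \cdot \mathrm{polylog}(\frac{|U|}{\epsilon}) \cdot \log (W|U|)\right)$ and computes a feasible solution $F \in \varphi(U,s)$ such that with probability at least $\frac{1}{2}$, $F$ is a $(1+O(\epsilon))$-approximate solution.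
   Context: A feasible solution $F=(Q,s')$ is a $(1+\epsilon)$-approximate solution to the instance $(U,s,W,w)$ if $\sum_{e\in Q}w(e)\le(1+\epsilon)\mathrm{OPT}$, where $\mathrm{OPT}$ is the minimum of $\sum_{e\in Q'}w(e)$ over all $(Q',s'')\in\varphi(U,s)$. *)

(* Defs.v *)
From HB Require Import structures.
From mathcomp Require Import all_boot all_order all_algebra finmap.
From mathcomp Require Import all_classical all_reals all_analysis.

Set Implicit Arguments.
Unset Strict Implicit.
Unset Printing Implicit Defensive.

(* * A randomized word RAM

   Structured programs over finitely many registers and arrays (both named by
   natural numbers), a read-only random-access input, a write-only output tape,
   and unit-cost instructions.  All registers and arrays initially hold 0. *)

Inductive binop :=
  | AddOp | SubOp | MulOp | DivOp | ModOp | LtOp | EqOp | AndOp | OrOp | XorOp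
  | ShlOp | ShrOp.

Definition eval_binop (o : binop) (m n : nat) : nat :=
  match o with
  | AddOp => m + n
  | SubOp => m - n
  | MulOp => m * n
  | DivOp => m %/ n
  | ModOp => m %% n
  | LtOp => m < n
  | EqOp => m == n
  | AndOp => Nat.land m n
  | OrOp => Nat.lor m n
  | XorOp => Nat.lxor m n
  | ShlOp => m * 2 ^ n
  | ShrOp => m %/ 2 ^ n
  end.

Inductive prog :=
  | Skip
  | Const (x : nat) (n : nat)          (* r_x := n                          *)
  | Op (x : nat) (o : binop) (y z : nat) (* r_x := r_y o r_z                *)
  | Fetch (x a y : nat)                (* r_x := a[r_y]                     *)
  | Store (a y z : nat)                (* a[r_y] := r_z                     *)
  | Input (x f y : nat)                (* r_x := r_y-th word of input row f *)
  | Rand (x y : nat)                   (* r_x := r_y fresh random bits      *)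
  | Output (x : nat)                   (* append r_x to the output tape     *)
  | Seq (p q : prog)
  | If (x : nat) (p q : prog)          (* tests r_x != 0                    *)
  | While (x : nat) (p : prog).

Record state := State {
  reg : nat -> nat;
  arr : nat -> nat -> nat;
  out : seq nat }.

Definition init_state : state := State (fun=> 0) (fun _ _ => 0) [::].

Definition upd (T : Type) (f : nat -> T) (i : nat) (v : T) : nat -> T :=
  fun j => if j == i then v else f j.

Definition set_reg (st : state) (x v : nat) : state :=
  State (upd (reg st) x v) (arr st) (out st).

Definition set_arr (st : state) (a i v : nat) : state :=
  State (reg st) (upd (arr st) a (upd (arr st a) i v)) (out st).

Definition emit (st : state) (v : nat) : state :=
  State (reg st) (arr st) (rcons (out st) v).

Definition nat_of_bits (bs : seq bool) : nat :=
  foldl (fun n b => n.*2 + nat_of_bool b) 0 bs.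

(* [exec B inp p st t bs st']: on input [inp], started in [st], the program [p]
   halts in [st'] after exactly [t] steps, having consumed exactly the random
   bits [bs].  Words are the naturals below [B]; there is no wrap-around, an
   instruction whose result is not a word has no transition. *)
Inductive exec (B : nat) (inp : seq (seq nat)) :
    prog -> state -> nat -> seq bool -> state -> Prop :=
  | ExecSkip st : exec B inp Skip st 1 [::] st
  | ExecConst st x n of n < B :
      exec B inp (Const x n) st 1 [::] (set_reg st x n)
  | ExecOp st x o y z of eval_binop o (reg st y) (reg st z) < B :
      exec B inp (Op x o y z) st 1 [::]
        (set_reg st x (eval_binop o (reg st y) (reg st z)))
  | ExecFetch st x a y :
      exec B inp (Fetch x a y) st 1 [::]
        (set_reg st x (arr st a (reg st y)))
  | ExecStore st a y z :
      exec B inp (Store a y z) st 1 [::] (set_arr st a (reg st y) (reg st z))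
  | ExecInput st x f y of nth 0 (nth [::] inp f) (reg st y) < B :
      exec B inp (Input x f y) st 1 [::]
        (set_reg st x (nth 0 (nth [::] inp f) (reg st y)))
  | ExecRand st x y bs of size bs = reg st y & 2 ^ reg st y <= B :
      exec B inp (Rand x y) st 1 bs (set_reg st x (nat_of_bits bs))
  | ExecOutput st x :
      exec B inp (Output x) st 1 [::] (emit st (reg st x))
  | ExecSeq p q st1 st2 st3 t u bs cs of
      exec B inp p st1 t bs st2 & exec B inp q st2 u cs st3 :
      exec B inp (Seq p q) st1 (t + u) (bs ++ cs) st3
  | ExecIfT x p q st t bs st' of
      reg st x != 0 & exec B inp p st t bs st' :
      exec B inp (If x p q) st t.+1 bs st'
  | ExecIfF x p q st t bs st' of
      reg st x = 0 & exec B inp q st t bs st' :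
      exec B inp (If x p q) st t.+1 bs st'
  | ExecWhileT x p st1 st2 st3 t u bs cs of
      reg st1 x != 0 & exec B inp p st1 t bs st2 &
      exec B inp (While x p) st2 u cs st3 :
      exec B inp (While x p) st1 (t + u).+1 (bs ++ cs) st3
  | ExecWhileF x p st of reg st x = 0 :
      exec B inp (While x p) st 1 [::] st.

(* With random tape [r], [p] halts within [t] steps, reading at most all of
   [r], and its output tape is [o]. *)
Definition outputs (B : nat) (inp : seq (seq nat)) (p : prog) (t : nat)
    (r : seq bool) (o : seq nat) : Prop :=
  exists bs rest u st,
    [/\ r = bs ++ rest, u <= t, exec B inp p init_state u bs st & out st = o].

(* Probability of an event over [L] independent fair coin tosses. *)
Definition Pr (L : nat) (E : L.-tuple bool -> Prop) : rat :=
  (#|[pred r : L.-tuple bool | `[< E r >]]|%:R / (2 ^ L)%:R)%R.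

(* * The optimization problem *)

Definition solution : Type := ({fset nat} * seq bool)%type.

Definition problem : Type := {fset nat} -> seq bool -> set solution.

Definition well_formed (phi : problem) : Prop :=
  forall U s F, phi U s F -> (F.1 `<=` U)%fset.

(* Only the values of [weight] on [univ] are meaningful. *)
Record instance := Instance {
  univ : {fset nat};
  str : seq bool;
  maxw : nat;
  weight : nat -> nat }.

Definition valid (I : instance) : Prop :=
  0 < maxw I /\ forall e, e \in univ I -> 0 < weight I e <= maxw I.

Definition cost (I : instance) (F : solution) : nat :=
  \sum_(e <- F.1) weight I e.

Definition feasible (phi : problem) (I : instance) (F : solution) : Prop :=
  phi (univ I) (str I) F.

Definition is_opt (phi : problem) (I : instance) (o : nat) : Prop :=
  (exists2 F, feasible phi I F & cost I F = o) /\
  (forall F, feasible phi I F -> o <= cost I F).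

Definition approx_solution (phi : problem) (I : instance) (d : rat)
    (F : solution) : Prop :=
  feasible phi I F /\
  exists2 o, is_opt phi I o & ((cost I F)%:R <= (1 + d) * o%:R)%R.

(* * Randomized algorithms for the problem *)

(* The input rows: a header, the elements of the universe in increasing order,
   their weights in the same order, and the bits of the string.  The parameter
   is given by its reduced numerator and denominator. *)
Definition input_of (I : instance) (eps : rat) : seq (seq nat) :=
  let us := sort leq (univ I) in
  [:: [:: #|` univ I|; size (str I); maxw I; `|numq eps|%N; `|denq eps|%N];
      us; map (weight I) us; map nat_of_bool (str I)].

Definition magnitude (inp : seq (seq nat)) : nat :=
  (\max_(x <- flatten inp) x).+2.

(* A pair (Q, s') is written as |Q|, the elements of Q in any order without
   repetition, then the bits of s'. *)
Definition encodes (o : seq nat) (F : solution) : Prop :=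
  exists q : seq nat,
    [/\ uniq q, q =i F.1 & o = size q :: q ++ map nat_of_bool F.2].

(* The output is feasible and the time bound holds for every outcome of the
   coin tosses; only the approximation guarantee is probabilistic.  Words have
   [c * log2 (magnitude + time)] bits for a constant [c]. *)
Definition randomized_approx (R : realType) (phi : problem) (p : prog)
    (bound : instance -> rat -> R) (d : rat -> rat) : Prop :=
  exists c : nat, forall (I : instance) (eps : rat),
    valid I -> (0 < eps < 1)%R ->
    exists t L : nat,
      let inp := input_of I eps in
      let B := (magnitude inp + t) ^ c in
      let result (r : L.-tuple bool) (F : solution) :=
        exists2 o, outputs B inp p t r o & encodes o F in
      [/\ (t%:R <= bound I eps)%R,
          forall r : L.-tuple bool,
            exists2 F, result r F & feasible phi I F &
          (1 / 2 <= Pr (fun r : L.-tuple bool =>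
             exists2 F, result r F & approx_solution phi I (d eps) F))%R].

(* Logarithms in running times are shifted by 2 so that they are bounded away
   from 0 on the degenerate arguments 0 and 1. *)
Definition shifted_ln (R : realType) (x : R) : R := ln (x + 2)%R.

(* Main.v *)
Require Import Defs.
From HB Require Import structures.
From mathcomp Require Import all_boot all_order all_algebra finmap.
From mathcomp Require Import all_classical all_reals all_analysis.
From mathcomp Require Import zify ring lra.

Set Implicit Arguments.
Unset Strict Implicit.
Unset Printing Implicit Defensive.

(* Let n = |U|. For every power of two g up to n W + 1, replace w(e) by
   w(e) n / (eps g), rounded up and truncated just above 6 n / eps, and run A
   on the resulting instance, whose largest weight is O(n / eps).  The answer of
   least original cost over all guesses g is returned.  When
   g <= OPT < 2 g, a (1 + eps)-approximate answer for the scaled weights uses no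
   truncated element, and the n rounding errors of eps g / n each add up to at
   most eps OPT, so it costs at most (1 + eps)^2 OPT <= (1 + 3 eps) OPT.  All
   answers are feasible, hence only the run for this one guess has to succeed,
   and probability 1/2 is kept without amplification.

   On the word RAM, A is simulated with shifted registers, its input rows and
   output tape kept in arrays, and time-stamped cells for its own arrays, so
   that starting a new run does not require erasing memory. *)

(** * Coin tosses and timed executions *)

(** Both bounds on the right guess matter: g <= OPT makes the rounding error small relative to OPT,
    and OPT < 2 g keeps near-optimal answers below the truncation level, which must not depend on W.
    All scaled instances share the universe, the string, the parameter and the largest weight, so a
    single time bound covers every run of A, with log(n / eps) in place of log W.

    The runs read consecutive portions of one random tape, and where a run stops reading depends on
    the tosses themselves, so the portions are not blocks of fixed length in a product space. The
    composition rules therefore allow at most one part that succeeds only with probability 1/2, all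
    others succeeding on every tape; no product of probabilities occurs. The guarantee travels
    through the rounds as a property of costs that passes to smaller costs, so keeping the cheapest
    answer cannot destroy it. *)

Fixpoint count_bits (L : nat) (E : seq bool -> Prop) : nat :=
  if L is L'.+1 then
    count_bits L' (fun r => E (true :: r)) +
    count_bits L' (fun r => E (false :: r))
  else `[< E [::] >].

(** Events are predicates on sequences, not on tuples of a fixed length, so that they can be cut
    after any prefix; the recursion on the first toss supports induction along the tape. *)
Lemma card_count_bits L (E : seq bool -> Prop) :
  #|[pred r : L.-tuple bool | `[< E r >]]| = count_bits L E.
Proof.
elim: L E => [|L IH] E /=.
  case: (asboolP (E [::])) => HE.
    rewrite -[RHS](card_tuple 0 bool) ; apply: eq_card => r.
    by rewrite !inE tuple0 /=; apply/asboolP.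
  by apply: eq_card0 => r; rewrite !inE tuple0 /=; apply/asboolP.
rewrite -!IH -!sum1_card.
have bij : bijective (fun bt : bool * L.-tuple bool => [tuple of bt.1 :: bt.2]).
  exists (fun t : L.+1.-tuple bool => (thead t, [tuple of behead t])).
    by case=> b t /=; congr pair; apply/val_inj.
  by move=> t /=; rewrite -tuple_eta.
rewrite (reindex _ (onW_bij _ bij)) /=.
rewrite -(pair_big_dep xpredT
  (fun b (t : L.-tuple bool) => `[< E (b :: t) >]) (fun _ _ => 1)) /=.
by rewrite big_bool.
Qed.

Lemma count_bits_le L (E1 E2 : seq bool -> Prop) :
  (forall r, size r = L -> E1 r -> E2 r) -> count_bits L E1 <= count_bits L E2.
Proof.
elim: L E1 E2 => [|L IH] E1 E2 H /=.
  by case: (asboolP (E1 _)) => // h1; case: asboolP => // -[]; apply: H.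
by apply: leq_add; apply: IH => r sr; apply: H; rewrite /= sr.
Qed.

Lemma count_bits_extend L1 L2 (E1 E2 : seq bool -> Prop) :
  (forall r s, size r = L1 -> size s = L2 -> E1 r -> E2 (r ++ s)) ->
  2 ^ L2 * count_bits L1 E1 <= count_bits (L1 + L2) E2.
Proof.
elim: L1 E1 E2 => [|L1 IH] E1 E2 H /=.
  case: (asboolP (E1 _)) => [h1|]; last by rewrite muln0.
  rewrite muln1 add0n.
  have {H} : forall s, size s = L2 -> E2 s.
    by move=> s sL; apply: (H [::]).
  elim: L2 E2 {h1} => [|L2 IH] E2 H /=; first by case: asboolP => // -[];
    exact: H.
  by rewrite expnS mul2n -addnn leq_add // IH // => s sL; apply: H;
    rewrite /= sL.
rewrite mulnDr leq_add //; apply: IH => r s rL; apply: (H (_ :: r));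
  by rewrite /= rL.
Qed.

(* The random bits that an execution consumes form a prefix-free set of words,
   so the bits that follow a consumed prefix are again uniform. *)
Lemma count_bits_after_prefix L1 L2 (E : seq bool -> Prop) :
  (forall r s, E r -> E (r ++ s)) ->
  (forall r, size r = L1 -> exists bs rest, r = bs ++ rest /\
     2 ^ L2 <= 2 * count_bits L2 (fun s => E (bs ++ s))) ->
  2 ^ (L1 + L2) <= 2 * count_bits (L1 + L2) E.
Proof.
elim: L1 E => [|L1 IH] E up H.
  by have [bs [rest [/esym/nilP]]] := H [::] erefl;
    rewrite cat_nilp => /andP[/nilP-> _].
(* If the empty prefix already works, further tosses are harmless by [up]. Otherwise every prefix
   given by [H] is nonempty, and the induction hypothesis applies after either value of the first
   toss. *)
have [h0|h0] := boolP (2 ^ L2 <= 2 * count_bits L2 E).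
  have := @count_bits_extend L2 L1.+1 E E (fun r s _ _ => up r s).
  rewrite addnC expnD; move: h0; set a := count_bits _ _;
    set b := count_bits _ _.
  set c := 2 ^ L2; set d := 2 ^ L1.+1 => h1 h2.
  by nia.
rewrite addSn expnS /= mul2n -addnn mulnDr.
apply: leq_add; apply: IH => [r s|r sr]; try exact: (up (_ :: r)).
- have [|[|b bs] [rest [/= E1 E2]]] := H (true :: r); rewrite /= ?sr //.
    by rewrite E2 in h0.
  by case: E1 E2 => <- -> E2; exists bs, rest.
- have [|[|b bs] [rest [/= E1 E2]]] := H (false :: r); rewrite /= ?sr //.
    by rewrite E2 in h0.
  by case: E1 E2 => <- -> E2; exists bs, rest.
Qed.

(* [on_coins g L E]: over [L] coin tosses, [E] holds with probability at least
   1/2 if [g], and surely otherwise. *)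
Definition on_coins (g : bool) (L : nat) (E : seq bool -> Prop) : Prop :=
  if g then 2 ^ L <= 2 * count_bits L E : Prop else forall r, size r = L -> E r.

Lemma on_coins_le g L (E E' : seq bool -> Prop) :
  (forall r, size r = L -> E r -> E' r) -> on_coins g L E -> on_coins g L E'.
Proof.
case: g => h /= h1.
  by apply: leq_trans h1 _; rewrite leq_mul2l /=; exact: count_bits_le.
by move=> r sr; apply: h => //; exact: h1.
Qed.

Lemma on_coins_widen g L L' (E : seq bool -> Prop) :
  L <= L' -> (forall r s, E r -> E (r ++ s)) ->
  on_coins g L E -> on_coins g L' E.
Proof.
move=> hL up; rewrite -(subnKC hL); case: g => /= h.
  have := @count_bits_extend L (L' - L) _ _ (fun r s _ _ => up r s).
  by move: h; rewrite expnD; nia.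
move=> r sr; rewrite -(cat_take_drop L r); apply/up/h.
by rewrite size_takel // sr; lia.
Qed.

(** [M u bs st] abstracts an execution from a fixed start that takes [u] steps, reads [bs] and ends
    in [st], so that one composition rule serves both [Seq] and [While]. *)
Definition yields (M : nat -> seq bool -> state -> Prop) (t : nat)
    (Q : state -> Prop) (r : seq bool) : Prop :=
  exists bs rest u st, [/\ r = bs ++ rest, u <= t, M u bs st & Q st].

Definition run (g : bool) (L : nat) (M : nat -> seq bool -> state -> Prop)
    (t : nat) (Q : state -> Prop) : Prop :=
  on_coins g L (yields M t Q).

Lemma yields_cat M t Q r s : yields M t Q r -> yields M t Q (r ++ s).
Proof.
by move=> [bs [rest [u [st [-> h1 h2 h3]]]]]; exists bs, (rest ++ s), u, st;
  rewrite catA.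
Qed.

Lemma run_weaken g L L' M t t' (Q Q' : state -> Prop) :
  L <= L' -> t <= t' -> (forall st, Q st -> Q' st) ->
  run g L M t Q -> run g L' M t' Q'.
Proof.
move=> hL ht hQ h; apply: on_coins_widen hL (@yields_cat _ _ _) _.
apply: on_coins_le h => r _ [bs [rest [u [st [-> h1 h2 h3]]]]].
exists bs, rest, u, st.
by split=> //; [exact: leq_trans ht | exact: hQ].
Qed.

(** If the first part is the probable one, whatever follows its consumed prefix is enough tape for
    the sure second part; if it is the second, [count_bits_after_prefix] applies. The overhead [d]
    is 0 for a sequence and 1 for a loop iteration. *)
Lemma run_bind g1 g2 L1 L2 M N K d t1 t2 (Q1 Q2 : state -> Prop) :
  ~~ (g1 && g2) ->
  (forall u bs st v cs st', M u bs st -> N st v cs st' ->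
     K (d + u + v) (bs ++ cs) st') ->
  run g1 L1 M t1 Q1 ->
  (forall st, Q1 st -> run g2 L2 (N st) t2 Q2) ->
  run (g1 || g2) (L1 + L2) K (d + t1 + t2) Q2.
Proof.
move=> hg hK h1 h2.
have step bs u st s : u <= t1 -> M u bs st -> yields (N st) t2 Q2 s ->
    yields K (d + t1 + t2) Q2 (bs ++ s).
  move=> hu hM [cs [rest [v [st' [-> hv hN hQ]]]]].
  exists (bs ++ cs), rest, (d + u + v), st'.
  by split; [rewrite catA | lia | exact: hK hM hN | ].
case: g1 g2 hg h1 h2 => -[] // _ h1 h2 /=.
- apply: leq_trans (_ : 2 * (2 ^ L2 * count_bits L1 (yields M t1 Q1)) <= _).
    by move: h1; rewrite /= expnD; nia.
  rewrite leq_mul2l /=.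
  apply: count_bits_extend => r s sr ss [bs [rest [u [st [-> hu hM hQ]]]]].
  rewrite -catA; apply: step hu hM _.
  rewrite -(cat_take_drop L2 (rest ++ s)); apply: yields_cat.
  by apply: (h2 _ hQ); rewrite size_takel // size_cat ss leq_addl.
- apply: count_bits_after_prefix => [r s|r sr]; first exact: yields_cat.
  have [bs [rest [u [st [-> hu hM hQ]]]]] := h1 r sr.
  exists bs, rest; split=> //; apply: leq_trans (h2 _ hQ) _.
  rewrite leq_mul2l /=; apply: count_bits_le => s _; exact: step hu hM.
- move=> r sr; rewrite -(cat_take_drop L1 r).
  have [|bs [rest [u [st [-> hu hM hQ]]]]] := h1 (take L1 r).
    by rewrite size_takel // sr leq_addr.
  rewrite -catA; apply: step hu hM _.
  rewrite -(cat_take_drop L2 (rest ++ _)); apply: yields_cat.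
  apply: (h2 _ hQ); rewrite size_takel // size_cat size_drop sr addKn.
  exact: leq_addl.
Qed.

Definition runs (B : nat) (inp : seq (seq nat)) (g : bool) (L : nat) (p : prog)
    (st : state) (t : nat) (Q : state -> Prop) : Prop :=
  run g L (exec B inp p st) t Q.

Lemma runs_exec B inp p st u st' t (Q : state -> Prop) :
  exec B inp p st u [::] st' -> u <= t -> Q st' ->
  runs B inp false 0 p st t Q.
Proof. by move=> h1 h2 h3 r _; exists [::], r, u, st'. Qed.

Lemma runs_seq B inp g1 g2 L1 L2 p q st t1 t2 (Q1 Q2 : state -> Prop) :
  ~~ (g1 && g2) ->
  runs B inp g1 L1 p st t1 Q1 ->
  (forall st', Q1 st' -> runs B inp g2 L2 q st' t2 Q2) ->
  runs B inp (g1 || g2) (L1 + L2) (Seq p q) st (t1 + t2) Q2.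
Proof.
move=> hg h1 h2; rewrite -[t1 + t2]/(0 + t1 + t2).
apply: (run_bind hg _ h1 h2) => u bs st1 v cs st2 hM hN.
exact: ExecSeq hM hN.
Qed.

Lemma runs_whileT B inp g1 g2 L1 L2 x p st t1 t2 (Q1 Q2 : state -> Prop) :
  reg st x != 0 -> ~~ (g1 && g2) ->
  runs B inp g1 L1 p st t1 Q1 ->
  (forall st', Q1 st' -> runs B inp g2 L2 (While x p) st' t2 Q2) ->
  runs B inp (g1 || g2) (L1 + L2) (While x p) st (t1 + t2).+1 Q2.
Proof.
move=> hx hg h1 h2; rewrite -add1n addnA.
apply: (run_bind hg _ h1 h2) => u bs st1 v cs st2 hM hN.
by rewrite -addnA add1n; exact: ExecWhileT hM hN.
Qed.

Lemma runs_while B inp x p (Inv : nat -> state -> Prop) n L tb :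
  (forall st, Inv n st -> reg st x = 0) ->
  (forall j st, j < n -> Inv j st ->
     reg st x != 0 /\ runs B inp false L p st tb (Inv j.+1)) ->
  forall d j st, j + d = n -> Inv j st ->
  runs B inp false (d * L) (While x p) st (d * tb.+1).+1 (Inv n).
Proof.
move=> h0 h1; elim=> [|d IH] j st hj hI.
  rewrite addn0 in hj; rewrite hj in hI.
  by apply: (runs_exec _ (leqnn _) hI); apply: ExecWhileF; exact: h0 hI.
have [|hx hb] := h1 j st _ hI; first by lia.
rewrite mulSn.
have -> : (d.+1 * tb.+1).+1 = (tb + (d * tb.+1).+1).+1 by nia.
apply: (runs_whileT hx (g1 := false) (g2 := false) _ hb) => // st' hI'.
by apply: IH hI'; lia.
Qed.

(** Only iteration [k] is probable. The boolean of [Inv] records whether it has been passed, so its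
    effect is carried through the remaining sure iterations. *)
Lemma runs_while_once B inp x p (Inv : bool -> nat -> state -> Prop) n k L tb :
  k < n ->
  (forall h st, Inv h n st -> reg st x = 0) ->
  (forall h j st, j < n -> Inv h j st ->
     reg st x != 0 /\ runs B inp false L p st tb (Inv h j.+1)) ->
  (forall st, Inv false k st -> runs B inp true L p st tb (Inv true k.+1)) ->
  forall st, Inv false 0 st ->
  runs B inp true (n * L) (While x p) st (n * tb.+1).+1 (Inv true n).
Proof.
move=> kn h0 h1 h2.
suff H d j st : j + d = n -> j <= k -> Inv false j st ->
    runs B inp true (d * L) (While x p) st (d * tb.+1).+1 (Inv true n).
  by move=> st hI; apply: H hI.
elim: d j st => [|d IH] j st hj jk hI; first by lia.
have [|hx hb] := h1 false j st _ hI; first by lia.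
rewrite mulSn.
have -> : (d.+1 * tb.+1).+1 = (tb + (d * tb.+1).+1).+1 by nia.
case: (ltngtP j k) jk => // hjk _.
  apply: (runs_whileT hx (g1 := false) (g2 := true) _ hb) => // st' hI'.
  by apply: IH hI'; lia.
rewrite hjk in hI hj.
apply: (runs_whileT hx (g1 := true) (g2 := false) _ (h2 _ hI)) => // st' hI'.
apply: (runs_while (Inv := Inv true)) hI' => //; last lia.
  by move=> st1; apply: h0.
by move=> j1 st1; apply: h1.
Qed.

Lemma runs_seql B inp g L p q st t1 t2 (Q1 Q2 : state -> Prop) :
  runs B inp false 0 p st t1 Q1 ->
  (forall st', Q1 st' -> runs B inp g L q st' t2 Q2) ->
  runs B inp g L (Seq p q) st (t1 + t2) Q2.
Proof. exact: (@runs_seq _ _ false g 0 L). Qed.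

Lemma runs_seqr B inp g L p q st t1 t2 (Q1 Q2 : state -> Prop) :
  runs B inp g L p st t1 Q1 ->
  (forall st', Q1 st' -> runs B inp false 0 q st' t2 Q2) ->
  runs B inp g L (Seq p q) st (t1 + t2) Q2.
Proof.
move=> h1 h2; rewrite -(orbF g) -(addn0 L).
by apply: runs_seq h1 h2; rewrite andbF.
Qed.

(** * Loop-free code, counted loops and the simulation of a program *)

(** Loops and coin tosses get the precondition [False]: the calculus is only for deterministic
    loop-free code, whose time is bounded syntactically by [wp_time]. *)
Fixpoint wp (B : nat) (inp : seq (seq nat)) (p : prog) (st : state)
    (Q : state -> Prop) : Prop :=
  match p with
  | Skip => Q st
  | Const x n => n < B /\ Q (set_reg st x n)
  | Op x o y z =>
      eval_binop o (reg st y) (reg st z) < B /\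
      Q (set_reg st x (eval_binop o (reg st y) (reg st z)))
  | Fetch x a y => Q (set_reg st x (arr st a (reg st y)))
  | Store a y z => Q (set_arr st a (reg st y) (reg st z))
  | Input x f y =>
      nth 0 (nth [::] inp f) (reg st y) < B /\
      Q (set_reg st x (nth 0 (nth [::] inp f) (reg st y)))
  | Rand _ _ => False
  | Output x => Q (emit st (reg st x))
  | Seq p1 p2 => wp B inp p1 st (fun st' => wp B inp p2 st' Q)
  | If x p1 p2 =>
      (reg st x != 0 -> wp B inp p1 st Q) /\ (reg st x = 0 -> wp B inp p2 st Q)
  | While _ _ => False
  end.

Fixpoint wp_time (p : prog) : nat :=
  match p with
  | Seq p1 p2 => wp_time p1 + wp_time p2
  | If _ p1 p2 => (maxn (wp_time p1) (wp_time p2)).+1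
  | _ => 1
  end.

Lemma runs_wp B inp p st (Q : state -> Prop) :
  wp B inp p st Q -> runs B inp false 0 p st (wp_time p) Q.
Proof.
move=> h.
suff [u [st' [h1 h2 h3]]] : exists u st', 
    [/\ exec B inp p st u [::] st', u <= wp_time p & Q st'].
  exact: runs_exec h1 h2 h3.
elim: p st Q h => //=.
- by move=> st Q h; exists 1, st; split=> //; constructor.
- by move=> x n st Q [h1 h2]; eexists 1, _; split; last exact: h2;
    first constructor.
- by move=> x o y z st Q [h1 h2]; eexists 1, _; split; last exact: h2;
    first constructor.
- by move=> x a y st Q h2; eexists 1, _; split; last exact: h2;
    first constructor.
- by move=> x a y st Q h2; eexists 1, _; split; last exact: h2;
    first constructor.
- by move=> x a y st Q [h1 h2]; eexists 1, _; split; last exact: h2;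
    first constructor.
- by move=> x st Q h2; eexists 1, _; split; last exact: h2; first constructor.
- move=> p IHp q IHq st Q /IHp[u [st1 [e1 hu /IHq[v [st2 [e2 hv hQ]]]]]].
  by exists (u + v), st2; split; [exact: ExecSeq e1 e2 | exact: leq_add | ].
- move=> x p IHp q IHq st Q [h1 h2]; case: (eqVneq (reg st x) 0) => hx.
    have [u [st1 [e1 hu hQ]]] := IHq _ _ (h2 hx).
    by exists u.+1, st1; split=> //;
      [exact: ExecIfF | rewrite ltnS leq_max hu orbT].
  have [u [st1 [e1 hu hQ]]] := IHp _ _ (h1 hx).
  by exists u.+1, st1; split=> //; [exact: ExecIfT | rewrite ltnS leq_max hu].
Qed.

(* Stepping through long blocks with these rules keeps the values in the
   symbolic state normalized; unfolding [wp] at once is exponential. *)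
Section WpSteps.
Variables (B : nat) (inp : seq (seq nat)) (q : prog) (st : state).
Variable Q : state -> Prop.

Lemma wp_const x n :
  n < B -> wp B inp q (set_reg st x n) Q -> wp B inp (Seq (Const x n) q) st Q.
Proof. by []. Qed.

Lemma wp_op x o y z vy vz v :
  reg st y = vy -> reg st z = vz -> eval_binop o vy vz = v -> v < B ->
  wp B inp q (set_reg st x v) Q ->
  wp B inp (Seq (Op x o y z) q) st Q.
Proof. by move=> <- <- <-. Qed.

Lemma wp_input x f y j v :
  reg st y = j -> nth 0 (nth [::] inp f) j = v -> v < B ->
  wp B inp q (set_reg st x v) Q -> wp B inp (Seq (Input x f y) q) st Q.
Proof. by move=> <- <-. Qed.

Lemma wp_store a y z i v :
  reg st y = i -> reg st z = v ->
  wp B inp q (set_arr st a i v) Q -> wp B inp (Seq (Store a y z) q) st Q.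
Proof. by move=> <- <-. Qed.

Lemma wp_skip : Q st -> wp B inp Skip st Q.
Proof. by []. Qed.
End WpSteps.

Lemma runs_weaken B inp g L L' p st t t' (Q Q' : state -> Prop) :
  runs B inp g L p st t Q -> L <= L' -> t <= t' ->
  (forall st', Q st' -> Q' st') -> runs B inp g L' p st t' Q'.
Proof. by move=> h h1 h2 h3; apply: run_weaken h. Qed.

(* Registers below 20 and arrays below 5 are private to the scaling program; the
   simulated program lives above them. *)
Notation rT0 := 0 (only parsing).
Notation rT1 := 1 (only parsing).
Notation rOutLen := 2 (only parsing).
Notation rGuess := 3 (only parsing).
Notation rJ := 4 (only parsing).
Notation rFlag := 5 (only parsing).
Notation rN := 6 (only parsing).
Notation rW := 7 (only parsing).
Notation rNum := 8 (only parsing).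
Notation rDen := 9 (only parsing).
Notation rCap := 10 (only parsing).
Notation rLim := 11 (only parsing).
Notation rBestCost := 12 (only parsing).
Notation rBestLen := 13 (only parsing).
Notation rSum := 14 (only parsing).
Notation rMore := 15 (only parsing).
Notation rQ := 16 (only parsing).
Notation rCopy := 17 (only parsing).
Notation rNDen := 18 (only parsing).

Notation aHead := 0 (only parsing).
Notation aScaled := 1 (only parsing).
Notation aOut := 2 (only parsing).
Notation aWeight := 3 (only parsing).
Notation aBest := 4 (only parsing).

(** [rFlag] is the loop test and, after the body, also the constant 1 that increments [rJ]. *)
Definition For (rn : nat) (body : prog) : prog :=
  Seq (Const rJ 0) (Seq (Op rFlag LtOp rJ rn)
    (While rFlag (Seq body (Seq (Const rFlag 1)
       (Seq (Op rJ AddOp rJ rFlag) (Op rFlag LtOp rJ rn)))))).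

(** The invariant must tolerate writes to [rJ] and [rFlag], which belong to the loop control. Each
    iteration adds three control instructions and a test to the body; the final 3 counts two initial
    instructions and the last test. *)
Lemma runs_for B inp rn body (Inv : nat -> state -> Prop) n st :
  rn != rJ -> rn != rFlag -> 1 < B -> n < B -> reg st rn = n ->
  (forall j st' v, Inv j st' -> Inv j (set_reg st' rJ v)) ->
  (forall j st' v, Inv j st' -> Inv j (set_reg st' rFlag v)) ->
  (forall j st', j < n -> Inv j st' -> reg st' rJ = j -> reg st' rn = n ->
     wp B inp body st' (fun st'' =>
       [/\ Inv j.+1 st'', reg st'' rJ = j & reg st'' rn = n])) ->
  Inv 0 st ->
  runs B inp false 0 (For rn body) st (n * (wp_time body + 4) + 3) (Inv n).
Proof.
move=> nJ nF B1 nB hn hJ hF hb hI.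
pose Inv' j st' := [/\ Inv j st', reg st' rJ = j, reg st' rn = n &
                      reg st' rFlag = (j < n)].
have rnF : (rn == 5) = false by apply/negbTE.
have rnJ : (rn == 4) = false by apply/negbTE.
pose st1 := set_reg (set_reg st rJ 0) rFlag (0 < n).
have h1 : Inv' 0 st1.
  by split; rewrite /st1 /= /upd /= ?rnF ?rnJ //; apply/hF/hJ.
have hw : runs B inp false 0 (While rFlag (Seq body (Seq (Const rFlag 1)
       (Seq (Op rJ AddOp rJ rFlag) (Op rFlag LtOp rJ rn))))) st1
       (n * (wp_time body + 3).+1).+1 (Inv n).
  apply: (@runs_weaken _ _ _ (n * 0) _ _ _ (n * (wp_time body + 3).+1).+1 _
    (Inv' n)).
  - apply: (runs_while (Inv := Inv')) h1 => //.
      by move=> st' [_ _ _ ->]; rewrite ltnn.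
    move=> j st' jn [i1 i2 i3 i4]; split; first by rewrite i4 jn.
    apply: runs_seql; first by apply/runs_wp/(hb j).
    move=> st2 [k1 k2 k3] /=.
    rewrite -[3]/(wp_time (Seq (Const rFlag 1)
       (Seq (Op rJ AddOp rJ rFlag) (Op rFlag LtOp rJ rn)))).
    apply: runs_wp => /=; rewrite /upd /= ?rnF ?rnJ /= k2 k3 addn1.
    split=> //; split; first lia.
    split; first exact: leq_ltn_trans (leq_b1 _) B1.
    split; rewrite /= /upd /= ?rnF ?rnJ //.
    by apply/hF/hJ/hF.
  - by rewrite muln0.
  - by [].
  - by move=> st' [].
have -> : n * (wp_time body + 4) + 3 = 1 + (1 + (n * (wp_time body + 3).+1).+1).
  by rewrite -addnS; lia.
apply: (@runs_seql _ _ _ _ _ _ _ _ _ (fun st' => st' = set_reg st rJ 0)).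
  by apply: (@runs_wp _ _ (Const rJ 0)); split=> //; exact: ltnW.
move=> _ ->; apply: (@runs_seql _ _ _ _ _ _ _ _ _ (fun st' => st' = st1)).
  apply: (@runs_wp _ _ (Op rFlag LtOp rJ rn)); rewrite /= /upd /= rnJ hn.
  by split=> //; exact: leq_ltn_trans (leq_b1 _) B1.
by move=> _ ->.
Qed.

(** * Simulation of a program with time-stamped arrays *)

Definition frame (rs xs : seq nat) (st st' : state) : Prop :=
  [/\ forall x, x \notin rs -> reg st' x = reg st x,
      forall a, a \notin xs -> arr st' a = arr st a & out st' = out st].

Lemma frame_reg rs xs st st' x v :
  x \in rs -> frame rs xs st st' -> frame rs xs st (set_reg st' x v).
Proof.
move=> hx [h1 h2 h3]; split=> // y hy; rewrite /= /upd.
by case: eqP hy => [->|_ hy]; [rewrite hx | exact: h1].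
Qed.

Lemma frame_arr rs xs st st' a i v :
  a \in xs -> frame rs xs st st' -> frame rs xs st (set_arr st' a i v).
Proof.
move=> hx [h1 h2 h3]; split=> // y hy; rewrite /= /upd.
by case: eqP hy => [->|_ hy]; [rewrite hx | exact: h2].
Qed.

Definition sreg (x : nat) : nat := x + 20.
(** Each simulated array becomes two, its values at odd and its stamps at even numbers, above the
    private arrays 0 to 4. *)
Definition aVal (a : nat) : nat := a.*2 + 5.
Definition aStamp (a : nat) : nat := a.*2 + 6.

(* The arrays of the simulated program are never cleared: a cell is current if
   it carries the present guess as its time stamp, and reads as 0 otherwise. *)
Fixpoint simulate (p : prog) : prog :=
  match p with
  | Skip => Skip
  | Const x n => Const (sreg x) n
  | Op x o y z => Op (sreg x) o (sreg y) (sreg z)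
  | Fetch x a y =>
      Seq (Fetch rT0 (aStamp a) (sreg y))
        (Seq (Op rT0 EqOp rT0 rGuess)
           (If rT0 (Fetch (sreg x) (aVal a) (sreg y)) (Const (sreg x) 0)))
  | Store a y z =>
      Seq (Store (aVal a) (sreg y) (sreg z)) (Store (aStamp a) (sreg y) rGuess)
  | Input x f y =>
      if f == 0 then Fetch (sreg x) aHead (sreg y)
      else if f == 2 then Fetch (sreg x) aScaled (sreg y)
      else Input (sreg x) f (sreg y)
  | Rand x y => Rand (sreg x) (sreg y)
  | Output x =>
      Seq (Store aOut rOutLen (sreg x))
        (Seq (Const rT0 1) (Op rOutLen AddOp rOutLen rT0))
  | Seq p1 p2 => Seq (simulate p1) (simulate p2)
  | If x p1 p2 => If (sreg x) (simulate p1) (simulate p2)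
  | While x p1 => While (sreg x) (simulate p1)
  end.

(** Registers, unlike arrays, are erased before each run, so a bound on those that occur is needed;
    it depends on A alone and contributes a constant per round. *)
Fixpoint reg_bound (p : prog) : nat :=
  match p with
  | Skip => 0
  | Const x _ => x.+1
  | Op x _ y z => maxn x.+1 (maxn y.+1 z.+1)
  | Fetch x _ y => maxn x.+1 y.+1
  | Store _ y z => maxn y.+1 z.+1
  | Input x _ y => maxn x.+1 y.+1
  | Rand x y => maxn x.+1 y.+1
  | Output x => x.+1
  | Seq p1 p2 => maxn (reg_bound p1) (reg_bound p2)
  | If x p1 p2 => maxn x.+1 (maxn (reg_bound p1) (reg_bound p2))
  | While x p1 => maxn x.+1 (reg_bound p1)
  end.

Definition simulates (m i : nat) (inp : seq (seq nat)) (st st' : state) : Prop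
  :=
  [/\ forall x, x < m -> reg st' (sreg x) = reg st x,
      forall a y, arr st a y =
        if arr st' (aStamp a) y == i then arr st' (aVal a) y else 0,
      out st = mkseq (arr st' aOut) (reg st' rOutLen),
      reg st' rGuess = i &
      arr st' aHead =1 nth 0 (nth [::] inp 0) /\
      arr st' aScaled =1 nth 0 (nth [::] inp 2)].

(** The last clause keeps stamps from exceeding the present guess, so that doubling the guess makes
    every cell stale at once. *)
Definition sim_frame (i : nat) (st st' : state) : Prop :=
  [/\ forall x, 2 < x < 20 -> reg st' x = reg st x,
      forall a, a < 5 -> a != aOut -> arr st' a = arr st a,
      out st' = out st &
      forall a y, arr st' (aStamp a) y = arr st (aStamp a) y \/
                  arr st' (aStamp a) y = i].

(** Each step emits at most one word. This keeps the counter [rOutLen] a word during the simulation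
    and bounds the later loops over the answer by the running time of A. *)
Lemma exec_out_size B inp p st t bs st' :
  exec B inp p st t bs st' -> size (out st') <= size (out st) + t.
Proof.
elim=> //= *; rewrite ?size_rcons; lia.
Qed.

Lemma sregE x y : (sreg x == sreg y) = (x == y).
Proof. by rewrite eqn_add2r. Qed.

Lemma sreg_ge x y : y < 20 -> (sreg x == y) = false.
Proof. rewrite /sreg; lia. Qed.

Lemma sreg_ge' x y : y < 20 -> (y == sreg x) = false.
Proof. rewrite /sreg; lia. Qed.

Lemma sim_frame_trans i st1 st2 st3 :
  sim_frame i st1 st2 -> sim_frame i st2 st3 -> sim_frame i st1 st3.
Proof.
move=> [a1 a2 a3 a4] [b1 b2 b3 b4]; split.
- by move=> x hx; rewrite b1 // a1.
- by move=> a h1 h2; rewrite b2 // a2.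
- by rewrite b3.
- by move=> a y; case: (b4 a y) => ->; [exact: a4 | right].
Qed.

Lemma sim_frame_sreg i st x v : sim_frame i st (set_reg st (sreg x) v).
Proof.
split=> //=; last by left.
by move=> y /andP[_ hy]; rewrite /upd sreg_ge'.
Qed.

Lemma simulates_sreg m i inp st st' x v :
  simulates m i inp st st' ->
  simulates m i inp (set_reg st x v) (set_reg st' (sreg x) v).
Proof.
move=> [h1 h2 h3 h4 h5]; split=> //=; rewrite /upd ?sreg_ge' //.
by move=> y hy; rewrite sregE; case: eqP => // _; exact: h1.
Qed.

(** The factor 4 comes from [Fetch]: read the stamp, compare, test, then read or clear. The
    simulation reads the same bits [bs], hence probabilities carry over unchanged. Only input rows 0
    and 2, the header and the weights, may differ between the two inputs; they are served from
    [aHead] and [aScaled]. *)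
Lemma simulate_exec B B' m i inpA inp :
  B <= B' -> 1 < B' ->
  (forall f, f != 0 -> f != 2 -> nth [::] inp f = nth [::] inpA f) ->
  forall p st t bs st', exec B inpA p st t bs st' ->
  forall sg, reg_bound p <= m -> size (out st) + t < B' ->
  simulates m i inpA st sg ->
  exists u sg', [/\ u <= 4 * t, exec B' inp (simulate p) sg u bs sg',
                    simulates m i inpA st' sg' & sim_frame i sg sg'].
Proof.
move=> BB' B1 hinp p st t bs st'; elim=> {p st t bs st'}.
- move=> st sg _ _ hs; exists 1, sg; split=> //; first exact: ExecSkip.
  by split=> // *; left.
- move=> st x n hn sg _ _ hs; exists 1, (set_reg sg (sreg x) n).
  split=> //; last exact: sim_frame_sreg.
    by apply: ExecConst; exact: leq_trans BB'.
  exact: simulates_sreg.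
- move=> st x o y z hn sg /=; rewrite !geq_max => /and3P[hx hy hz] _ hs.
  have [h1 _ _ _ _] := hs.
  exists 1, (set_reg sg (sreg x) (eval_binop o (reg st y) (reg st z))).
  split=> //; last exact: sim_frame_sreg.
    rewrite -(h1 _ hy) -(h1 _ hz); apply: ExecOp.
    by rewrite (h1 _ hy) (h1 _ hz); exact: leq_trans BB'.
  exact: simulates_sreg.
- move=> st x a y sg /=; rewrite !geq_max => /andP[hx hy] _ hs.
  have [h1 h2 h3 h4 h5] := hs.
  set e := arr sg (aStamp a) (reg st y) == i.
  set sg1 := set_reg (set_reg sg rT0 (arr sg (aStamp a) (reg st y))) rT0 e.
  exists (1 + (1 + 2)), (set_reg sg1 (sreg x) (arr st a (reg st y)));
    split=> //.
  + rewrite -[[::]]/([::] ++ ([::] ++ [::] : seq bool)).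
    apply: ExecSeq; first exact: ExecFetch.
    rewrite h1 //.
    apply: (@ExecSeq _ _ _ _ _ sg1).
      have := @ExecOp B' inp (set_reg sg rT0 (arr sg (aStamp a) (reg st y)))
        rT0 EqOp rT0 rGuess.
      rewrite /= /upd /= h4 -/e; apply.
      by case: (e) => //; exact: ltnW.
    case he: e; rewrite h2 -/e he.
      apply: ExecIfT; first by rewrite /sg1 /= /upd /= he.
      have := @ExecFetch B' inp sg1 (sreg x) (aVal a) (sreg y).
      by have -> : reg sg1 (sreg y) = reg st y by rewrite /sg1 /= /upd !sreg_ge
        // h1.
    apply: ExecIfF; first by rewrite /sg1 /= /upd /= he.
    by apply: ExecConst; exact: ltnW.
  + apply: simulates_sreg; split=> //= z hz.
    by rewrite /upd !sreg_ge //; exact: h1.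
  + apply: sim_frame_trans (sim_frame_sreg _ _ _ _).
    split=> //=; last by left.
    by move=> [|z].
- move=> st a y z sg /=; rewrite !geq_max => /andP[hy hz] _ hs.
  have [h1 h2 h3 h4 h5] := hs.
  exists (1 + 1), (set_arr (set_arr sg (aVal a) (reg st y) (reg st z)) (aStamp
    a) (reg st y) i).
  have VS b c : (aVal b == aStamp c) = false by rewrite /aVal /aStamp; lia.
  have SV b c : (aStamp b == aVal c) = false by rewrite /aVal /aStamp; lia.
  have SS b c : (aStamp b == aStamp c) = (b == c) by rewrite /aVal /aStamp; lia.
  have VV b c : (aVal b == aVal c) = (b == c) by rewrite /aVal /aStamp; lia.
  split=> //.
  + rewrite -[[::]]/([::] ++ [::] : seq bool).
    apply: ExecSeq; first exact: ExecStore.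
    rewrite !h1 // -[X in exec _ _ _ _ _ _ (set_arr _ _ _ X)]h4.
    have := @ExecStore B' inp (set_arr sg (aVal a) (reg st y) (reg st z))
      (aStamp a) (sreg y) rGuess.
    by rewrite /= h1.
  + split=> //=.
      move=> b c; rewrite /upd SS !SV VS VV.
      case: (eqVneq b a) => _; last exact: h2.
      by case: (eqVneq c (reg st y)) => [_|_]; [rewrite eqxx | exact: h2].
      by rewrite /upd /aStamp /aVal ?addnS.
    by case: h5 => h5 h6; split=> c; rewrite /upd /aStamp /aVal ?addnS /=.
  + split=> //=.
      by move=> b hb hb'; rewrite /upd; do 2![case: eqP => [e|_]; [move: e;
        rewrite /aVal /aStamp; lia|]].
    move=> b c; rewrite /upd SS !SV.
    case: (eqVneq b a) => [eb|_]; rewrite ?eb; last by left.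
    by case: (eqVneq c (reg st y)) => _; [right | left].
- move=> st x f y hv sg /=; rewrite !geq_max => /andP[hx hy] _ hs.
  have [h1 h2 h3 h4 [h5 h6]] := hs.
  exists 1, (set_reg sg (sreg x) (nth 0 (nth [::] inpA f) (reg st y))).
  split=> //; [|exact: simulates_sreg|exact: sim_frame_sreg].
  case: eqP => [->|/eqP f0]; first by rewrite -h5 -h1 //; exact: ExecFetch.
  case: eqP => [->|/eqP f2]; first by rewrite -h6 -h1 //; exact: ExecFetch.
  rewrite -hinp // -h1 //; apply: ExecInput.
  by rewrite h1 // hinp //; exact: leq_trans BB'.
- move=> st x y bs hsz hB sg /=; rewrite !geq_max => /andP[hx hy] _ hs.
  have [h1 h2 h3 h4 [h5 h6]] := hs.
  exists 1, (set_reg sg (sreg x) (nat_of_bits bs)).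
  split=> //; [|exact: simulates_sreg|exact: sim_frame_sreg].
  by apply: ExecRand; rewrite h1 //; exact: leq_trans BB'.
- move=> st x sg /= hx ho hs.
  have [h1 h2 h3 h4 [h5 h6]] := hs.
  have hl : size (out st) = reg sg rOutLen by rewrite h3 size_mkseq.
  rewrite hl in ho.
  set sg1 := set_reg (set_arr sg aOut (reg sg rOutLen) (reg st x)) rT0 1.
  exists (1 + (1 + 1)), (set_reg sg1 rOutLen (reg sg rOutLen + 1)); split=> //.
  + rewrite -[[::]]/([::] ++ ([::] ++ [::] : seq bool)).
    apply: ExecSeq; first exact: ExecStore.
    rewrite h1 //.
    apply: (@ExecSeq _ _ _ _ _ sg1); first exact: ExecConst.
    have := @ExecOp B' inp sg1 rOutLen AddOp rOutLen rT0.
    by rewrite /= /upd /=; apply.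
  + split=> //=.
    * by move=> z hz; rewrite /upd !sreg_ge //; exact: h1.
    * by move=> b c; have := h2 b c; rewrite /upd /aStamp /aVal !addnS /=.
    * rewrite h3 addn1 /upd /= mkseqS eqxx; congr rcons.
      apply/eq_in_map => j; rewrite mem_iota => /andP[_ hj].
      by rewrite ltn_eqF.
  + split=> //=; [by move=> [|[|[|z]]]|by move=> [|[|[|z]]]|].
    by move=> b c; rewrite /upd /aStamp ?addnS /=; left.
- move=> p q st1 st2 st3 t u bs cs e1 IH1 e2 IH2 sg /=.
  rewrite geq_max => /andP[hp hq] ho hs.
  have [|u1 [sg1 [a1 a2 a3 a4]]] := IH1 sg hp _ hs; first lia.
  have ho1 := exec_out_size e1.
  have [|u2 [sg2 [b1 b2 b3 b4]]] := IH2 sg1 hq _ a3; first lia.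
  exists (u1 + u2), sg2; split=> //; first lia.
    exact: ExecSeq a2 b2.
  exact: sim_frame_trans b4.
- move=> x p q st t bs st' hx e1 IH1 sg /=.
  rewrite !geq_max => /and3P[hxm hp hq] ho hs.
  have [|u1 [sg1 [a1 a2 a3 a4]]] := IH1 sg hp _ hs; first lia.
  exists u1.+1, sg1; split=> //; first lia.
  by apply: ExecIfT => //; case: hs => ->.
- move=> x p q st t bs st' hx e1 IH1 sg /=.
  rewrite !geq_max => /and3P[hxm hp hq] ho hs.
  have [|u1 [sg1 [a1 a2 a3 a4]]] := IH1 sg hq _ hs; first lia.
  exists u1.+1, sg1; split=> //; first lia.
  by apply: ExecIfF => //; case: hs => ->.
- move=> x p st1 st2 st3 t u bs cs hx e1 IH1 e2 IH2 sg /= hxp.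
  move: (hxp); rewrite geq_max => /andP[hxm hp] ho hs.
  have [|u1 [sg1 [a1 a2 a3 a4]]] := IH1 sg hp _ hs; first lia.
  have ho1 := exec_out_size e1.
  have [|u2 [sg2 [b1 b2 b3 b4]]] := IH2 sg1 hxp _ a3; first lia.
  exists (u1 + u2).+1, sg2; split=> //; first lia.
    by apply: ExecWhileT a2 b2; case: hs => ->.
  exact: sim_frame_trans b4.
- move=> x p st hx sg /=; rewrite geq_max => /andP[hxm hp] _ hs.
  exists 1, sg; split=> //; last by split=> // *; left.
  by apply: ExecWhileF; case: hs => ->.
Qed.

(** * The scaling program *)

Fixpoint seqs (ps : seq prog) : prog :=
  if ps is p :: ps' then (if ps' is [::] then p else Seq p (seqs ps')) else
    Skip.

(** [rBestCost] starts at n W + 1, above every feasible cost, so that the first answer is always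
    kept. The strict limit n W + 2 on guesses admits g = 1 even when n = 0, so at least one round
    takes place. *)
Definition setup_consts : prog :=
  seqs [:: Const rT0 0; Input rN 0 rT0; Store aHead rT0 rN;
           Const rT0 1; Input rT1 0 rT0; Store aHead rT0 rT1;
           Const rT0 3; Input rNum 0 rT0; Store aHead rT0 rNum;
           Const rT0 4; Input rDen 0 rT0; Store aHead rT0 rDen;
           Op rNDen MulOp rN rDen; Const rT1 6; Op rCap MulOp rT1 rNDen;
           Op rCap DivOp rCap rNum;
           Const rT0 2; Input rW 0 rT0;
           Const rT1 1; Op rT1 AddOp rCap rT1; Store aHead rT0 rT1;
           Op rBestCost MulOp rN rW; Const rT1 1;
           Op rBestCost AddOp rBestCost rT1; Op rLim AddOp rBestCost rT1;
           Const rGuess 1; Op rMore LtOp rGuess rLim; Skip].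

(** Weights are tabulated by element, not by rank in the universe, because answers list elements. *)
Definition table_body : prog :=
  seqs [:: Input rT0 1 rJ; Input rT1 2 rJ; Store aWeight rT0 rT1].

(** Adding to a zeroed register is how the machine copies one; here it replaces a quotient that is
    not below [cap]. *)
Definition scale_body : prog :=
  seqs [:: Input rT0 2 rJ; Op rT0 MulOp rT0 rNDen; Op rT1 MulOp rNum rGuess;
           Op rT0 DivOp rT0 rT1; Op rT1 LtOp rT0 rCap;
           If rT1 Skip (Seq (Const rT0 0) (Op rT0 AddOp rT0 rCap));
           Const rT1 1; Op rT0 AddOp rT0 rT1; Store aScaled rJ rT0].

Fixpoint reset (m : nat) : prog :=
  if m is m'.+1 then Seq (reset m') (Const (sreg m') 0) else Const rOutLen 0.

(** The index is shifted by 1 since cell 0 of an encoded answer holds the number of its elements. *)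
Definition cost_body : prog :=
  seqs [:: Const rT0 1; Op rT0 AddOp rJ rT0; Fetch rT0 aOut rT0;
           Fetch rT0 aWeight rT0; Op rSum AddOp rSum rT0].

Definition cost_prog : prog :=
  Seq (seqs [:: Const rT0 0; Fetch rQ aOut rT0; Const rSum 0])
      (For rQ cost_body).

Definition copy_body : prog :=
  seqs [:: Fetch rT0 aOut rJ; Store aBest rJ rT0].

(** The loop length [rCopy] is 0 unless the answer improves on the best one; the copying loop thus
    stays outside the conditional, whose branches must be loop-free for [wp]. *)
Definition update_prog : prog :=
  Seq (seqs [:: Op rT0 LtOp rSum rBestCost; Op rCopy MulOp rT0 rOutLen;
                If rT0 (seqs [:: Const rT1 0; Op rBestCost AddOp rSum rT1;
                                 Op rBestLen AddOp rOutLen rT1]) Skip])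
      (For rCopy copy_body).

Definition next_prog : prog :=
  Seq (Op rGuess AddOp rGuess rGuess) (Op rMore LtOp rGuess rLim).

Definition emit_body : prog := Seq (Fetch rT0 aBest rJ) (Output rT0).

Definition round_prog (A : prog) : prog :=
  Seq (Seq (For rN scale_body) (reset (reg_bound A)))
      (Seq (simulate A) (Seq cost_prog (Seq update_prog next_prog))).

Definition scaling_prog (A : prog) : prog :=
  Seq (Seq setup_consts (For rN table_body))
      (Seq (While rMore (round_prog A)) (For rBestLen emit_body)).

Section Scaling.
Variables (I : instance) (eps : rat).

Let n := #|` univ I|.
Let W := maxw I.
Let a := `|numq eps|%N.
Let b := `|denq eps|%N.
Let us := sort leq (univ I).
Let inp := input_of I eps.

Definition cap : nat := 6 * (n * b) %/ a.

(* [eps = a / b], so the quotient is [w(e) n / (eps g)]; adding 1 after the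
   truncation rounds up, keeps weights positive and makes a truncated weight
   exceed [6 n / eps]. *)
Definition scaled_weight (g e : nat) : nat :=
  (minn (weight I e * (n * b) %/ (a * g)) cap).+1.

Definition scaled (g : nat) : instance :=
  Instance (univ I) (str I) cap.+1 (scaled_weight g).

(** An instruction whose result is not a word gets stuck, so the intermediate values of the program
    need bounds; the factor 2 in [fit_lim] is for the last doubling of the guess. *)
Record words_fit (B t : nat) : Prop := WordsFit {
  fit_six : 6 < B;
  fit_n : n < B;
  fit_str : size (str I) < B;
  fit_W : W < B;
  fit_num : a < B;
  fit_den : b < B;
  fit_cap : 6 * (n * b) + 1 < B;
  fit_scale : W * (n * b) < B;
  fit_div : a * (n * W + 2) < B;
  fit_lim : 2 * (n * W + 2) <= B;
  fit_univ : forall e, e \in univ I -> e < B;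
  fit_time : t + 1 < B }.

Variables (B t : nat).
Hypothesis validI : valid I.
Hypothesis fits : words_fit B t.

Lemma size_us : size us = n. Proof. by rewrite size_sort. Qed.

Lemma nth_us j : j < n -> nth 0 us j \in univ I.
Proof. by move=> jn; rewrite -(mem_sort leq) mem_nth // size_us. Qed.

Lemma weight_le e : e \in univ I -> weight I e <= W.
Proof. by case: validI => _ h /h /andP[]. Qed.

Lemma one_lt_B : 1 < B. Proof. by case: fits => *; lia. Qed.

Definition head_row : seq nat := [:: n; size (str I); cap.+1; a; b].

(** [ready_scaled] matters because A may read past the end of a row: [Input] yields 0 there, and so
    must the array that replaces the row. *)
Record ready (st : state) : Prop := Ready {
  ready_n : reg st rN = n;
  ready_num : reg st rNum = a;
  ready_cap : reg st rCap = cap;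
  ready_lim : reg st rLim = n * W + 2;
  ready_nden : reg st rNDen = n * b;
  ready_head : arr st aHead =1 nth 0 head_row;
  ready_weight : forall e, e \in univ I -> arr st aWeight e = weight I e;
  ready_scaled : forall y, n <= y -> arr st aScaled y = 0;
  ready_out : out st = [::] }.

Lemma cap_lt : cap + 1 < B.
Proof.
apply: leq_ltn_trans (fit_cap fits); rewrite leq_add2r; exact: leq_div.
Qed.

Local Ltac val := simpl; rewrite /upd; simpl; reflexivity.

Lemma setup_consts_wp :
  wp B inp setup_consts init_state (fun st =>
    [/\ [/\ reg st rN = n, reg st rNum = a, reg st rCap = cap,
            reg st rLim = n * W + 2 & reg st rNDen = n * b],
        arr st aHead =1 nth 0 head_row,
        [/\ reg st rGuess = 1, reg st rBestCost = n * W + 1 & reg st rMore = 1],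
        forall c, c != aHead -> arr st c = fun=> 0 & out st = [::]]).
Proof.
have := cap_lt; rewrite /cap => hc.
case: fits => f1 f2 f3 f4 f5 f6 f7 f8 f9 f10 f11 f12.
rewrite /setup_consts /seqs.
repeat lazymatch goal with
  | |- wp _ _ (Seq (Const _ _) _) _ _ => eapply wp_const; [by lia |]
  | |- wp _ _ (Seq (Op _ _ _ _) _) _ _ =>
      eapply wp_op; [val | val | simpl; reflexivity | by lia |]
  | |- wp _ _ (Seq (Input _ _ _) _) _ _ =>
      eapply wp_input;
        [val | rewrite /= -?/n -?/a -?/b -?/W; reflexivity | by lia |]
  | |- wp _ _ (Seq (Store _ _ _) _) _ _ => eapply wp_store; [val | val |]
  end.
apply: wp_skip.
rewrite /= /upd /=.
split=> //.
- by split=> //; lia.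
- by move=> [|[|[|[|[|y]]]]] /=; rewrite ?addn1 ?nth_nil.
- by split=> //; lia.
- by move=> c /negbTE ->.
Qed.

Lemma runs_setup :
  runs B inp false 0 (Seq setup_consts (For rN table_body)) init_state
    (wp_time setup_consts + (n * (wp_time table_body + 4) + 3))
    (fun st => [/\ ready st,
        [/\ reg st rGuess = 1, reg st rBestCost = n * W + 1 & reg st rMore = 1]
          &
        forall c y, arr st (aStamp c) y = 0]).
Proof.
apply: runs_seql; first exact/runs_wp/setup_consts_wp.
move=> st1 [[r1 r2 r3 r4 r5] r6 [r7 r8 r9] r10 r11].
pose Inv j st := frame [:: rT0; rT1; rJ; rFlag] [:: aWeight] st1 st /\
  forall i, i < j -> arr st aWeight (nth 0 us i) = weight I (nth 0 us i).
apply: (@runs_weaken _ _ _ 0 _ _ _ (n * (wp_time table_body + 4) + 3) _ (Inv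
  n)) => //; last first.
  move=> st [[h1 h2 h3] h4]; split.
  - split; rewrite ?h1 ?h3 //.
    + by move=> y; rewrite h2.
    + move=> e; rewrite -(mem_sort leq) -/us => he.
      rewrite -(nth_index 0 he).
      by rewrite h4 // -size_us index_mem.
    + by move=> y _; rewrite h2 // r10.
  - by rewrite !h1.
  - by move=> c y; rewrite h2 ?r10 // /aStamp !addnS.
case: fits => f1 f2 f3 f4 f5 f6 f7 f8 f9 f10 f11 f12.
apply: runs_for => //.
- exact: one_lt_B.
- by move=> j st v [h1 h2]; split=> //; exact: frame_reg.
- by move=> j st v [h1 h2]; split=> //; exact: frame_reg.
- move=> j st jn [h1 h2] hJ hN /=; rewrite /upd /= hJ.
  rewrite (nth_map 0) ?size_us //.
  have hU := nth_us jn.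
  split; first exact: f11.
  split; first exact: leq_ltn_trans (weight_le hU) f4.
  split=> //; split.
    by apply: frame_arr => //; apply: frame_reg => //; exact: frame_reg.
  move=> i; rewrite ltnS leq_eqVlt /= /upd /= => hi.
  case: eqP => [->//|ne]; case/orP: hi => [/eqP ei|];
    [by rewrite ei in ne|exact: h2].
Qed.

Lemma scaled_bound g : forall e, scaled_weight g e <= cap.+1.
Proof. by move=> e; rewrite ltnS geq_minr. Qed.

Lemma runs_scale st g :
  ready st -> reg st rGuess = g -> 0 < g < n * W + 2 ->
  runs B inp false 0 (For rN scale_body) st
    (n * (wp_time scale_body + 4) + 3)
    (fun st' => frame [:: rT0; rT1; rJ; rFlag] [:: aScaled] st st' /\
       arr st' aScaled =1 nth 0 (map (scaled_weight g) us)).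
Proof.
move=> rd hg /andP[g0 gl].
pose Inv j st' := frame [:: rT0; rT1; rJ; rFlag] [:: aScaled] st st' /\
  (forall i, i < j -> arr st' aScaled i = scaled_weight g (nth 0 us i)) /\
  (forall i, n <= i -> arr st' aScaled i = 0).
apply: (@runs_weaken _ _ _ 0 _ _ _ (n * (wp_time scale_body + 4) + 3) _ (Inv
  n)) => //; last first.
  move=> st' [h1 [h2 h3]]; split=> // i.
  case: (ltnP i n) => hi; first by rewrite (nth_map 0) ?size_us // h2.
  by rewrite nth_default ?size_map ?size_us // h3.
have hcap := cap_lt.
case: fits => f1 f2 f3 f4 f5 f6 f7 f8 f9 f10 f11 f12.
case: rd => r1 r2 r3 r4 r5 r6 r7 r8 r9.
apply: runs_for => //.
- exact: one_lt_B.
- by move=> j st' v [h1 h2]; split=> //; exact: frame_reg.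
- by move=> j st' v [h1 h2]; split=> //; exact: frame_reg.
- move=> j st' jn [h1 [h2 h3]] hJ hN.
  have hU := nth_us jn; have hw := weight_le hU.
  have [q1 _ _] := h1.
  have e2 : reg st' rNum = a by rewrite q1.
  have e3 : reg st' rCap = cap by rewrite q1.
  have e5 : reg st' rNDen = n * b by rewrite q1.
  have eg : reg st' rGuess = g by rewrite q1.
  rewrite /= /upd /= hJ (nth_map 0) ?size_us // e2 e3 e5 eg.
  have lt1 : weight I (nth 0 us j) * (n * b) < B.
    by apply: leq_ltn_trans f8; rewrite leq_mul2r hw orbT.
  split; first exact: leq_ltn_trans hw f4.
  split=> //.
  split; first by apply: leq_ltn_trans f9; rewrite leq_mul2l ltnW ?orbT.
  split; first exact: leq_ltn_trans (leq_div _ _) lt1.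
  split; first exact: leq_ltn_trans (leq_b1 _) one_lt_B.
  set v := weight I (nth 0 us j) * (n * b) %/ (a * g).
  have fin x st3 : x = minn v cap -> 
     frame [:: rT0; rT1; rJ; rFlag] [:: aScaled] st' st3 ->
     arr st3 aScaled = arr st' aScaled ->
     Inv j.+1 (set_arr st3 aScaled j x.+1).
    move=> -> fr ea; split.
      apply: frame_arr => //; case: fr => u1 u2 u3; case: h1 => v1 v2 v3.
      by split=> [y hy|y hy|]; rewrite ?u1 ?u2 ?u3 ?v1 ?v2 ?v3.
    rewrite /= /upd /= ea; split=> i.
      rewrite ltnS leq_eqVlt; case: eqP => [->//|_] /=; exact: h2.
    by move=> ni; rewrite ifF; [exact: h3 | apply/negbTE; lia].
  split=> hc.
  + have vc : v < cap by move: hc; case: (v < cap).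
    split; first exact: one_lt_B.
    split; first by lia.
    split=> //; rewrite addn1; apply: fin => //=.
    * by rewrite (minn_idPl _) // ltnW.
    * by do ?[apply: frame_reg => //].
  + have vc : cap <= v by move: hc; case: ltnP.
    split; first by lia.
    split; first by lia.
    split; first exact: one_lt_B.
    rewrite add0n; split; first by lia.
    split=> //; rewrite addn1; apply: fin => //=.
    * by rewrite (minn_idPr _).
    * by do ?[apply: frame_reg => //].
Qed.

Lemma reset_wp m st (Q : state -> Prop) :
  (forall st', [/\ forall x, x < 20 -> x != rOutLen -> reg st' x = reg st x,
      arr st' = arr st, out st' = out st, reg st' rOutLen = 0 &
      forall x, x < m -> reg st' (sreg x) = 0] -> Q st') ->
  wp B inp (reset m) st Q.
Proof.
have := one_lt_B => B1.
elim: m Q => [|m IH] Q h /=.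
  split; first lia.
  apply: h; split=> //= x _ /negbTE; by rewrite /upd => ->.
apply: IH => st' [h1 h2 h3 h4 h5]; split; first lia.
apply: h; split=> //=; rewrite /upd.
- by move=> x hx hx'; rewrite sreg_ge' // h1.
- by rewrite sreg_ge'.
- by move=> x; rewrite sregE ltnS leq_eqVlt; case: eqP => //= _; exact: h5.
Qed.

Lemma reset_time m : wp_time (reset m) = m.+1.
Proof. by elim: m => //= m ->; rewrite addn1. Qed.

Lemma sum_weight_le (q : seq nat) :
  uniq q -> {subset q <= univ I} -> \sum_(e <- q) weight I e <= n * W.
Proof.
move=> uq sq; apply: (@leq_trans (\sum_(e <- q) W)).
  rewrite [X in X <= _]big_seq [X in _ <= X]big_seq; apply: leq_sum => e he.
  exact/weight_le/sq.
rewrite big_const_seq count_predT iter_addn_0 mulnC leq_mul2r; apply/orP; right.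
exact: uniq_leq_size.
Qed.

Lemma runs_cost st q rest :
  mkseq (arr st aOut) (reg st rOutLen) = size q :: q ++ rest ->
  uniq q -> {subset q <= univ I} -> ready st -> reg st rOutLen <= t ->
  runs B inp false 0 cost_prog st (3 + (t * (wp_time cost_body + 4) + 3))
    (fun st' => frame [:: rT0; rT1; rJ; rFlag; rSum; rQ] [::] st st' /\
       reg st' rSum = \sum_(e <- q) weight I e).
Proof.
move=> ho uq sq rd hl.
have hL : (size q + size rest).+1 = reg st rOutLen.
  by have := congr1 size ho; rewrite size_mkseq /= size_cat.
have ho0 : arr st aOut 0 = size q.
  have := congr1 (nth 0 ^~ 0) ho; rewrite /= => <-.
  by rewrite nth_mkseq // -hL.
have hoj j : j < size q -> arr st aOut j.+1 = nth 0 q j.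
  move=> jq; have := congr1 (nth 0 ^~ j.+1) ho; rewrite /= nth_cat jq => <-.
  rewrite nth_mkseq // -hL ltnS; apply: leq_trans jq _; exact: leq_addr.
have hsum j : \sum_(e <- take j q) weight I e <= n * W.
  by apply: sum_weight_le; [exact: take_uniq | move=> e /mem_take /sq].
case: fits => f1 f2 f3 f4 f5 f6 f7 f8 f9 f10 f11 f12.
apply: (@runs_seql _ _ _ _ _ _ _ _ _ (fun st' => 
   [/\ frame [:: rT0; rT1; rJ; rFlag; rSum; rQ] [::] st st', reg st' rQ = size q
     & reg st' rSum = 0])).
  apply: (@runs_wp _ _ (seqs _)); rewrite /= /upd /=.
  split; first lia.
  split; first lia.
  split=> //=; first by do ?[apply: frame_reg => //].
move=> st1 [fr1 hq hs].
pose Inv j st' := frame [:: rT0; rT1; rJ; rFlag; rSum; rQ] [::] st st' /\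
  reg st' rSum = \sum_(e <- take j q) weight I e.
have sqt : size q <= t by lia.
apply: (@runs_weaken _ _ _ 0 _ _ _ (size q * (wp_time cost_body + 4) + 3) _
  (Inv (size q))) => //; last first.
- by move=> st' [h1]; rewrite take_size.
- by rewrite leq_add2r leq_mul2r sqt orbT.
apply: runs_for => //.
- exact: one_lt_B.
- by lia.
- by move=> j st' v [h1 h2]; split=> //; exact: frame_reg.
- by move=> j st' v [h1 h2]; split=> //; exact: frame_reg.
- move=> j st' jq [h1 h2] hJ hN /=; have [_ q2 _] := h1.
  rewrite /upd /= hJ addn1 !q2 // hoj // h2.
  rewrite (ready_weight rd) ?sq ?mem_nth //.
  have st3 : \sum_(e <- take j q) weight I e + weight I (nth 0 q j) =
             \sum_(e <- take j.+1 q) weight I e.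
    by rewrite (take_nth 0) // -cats1 big_cat big_seq1.
  rewrite st3.
  split; first lia.
  split; first lia.
  split; first by have := hsum j.+1; lia.
  split=> //; split=> //.
  by do ?[apply: frame_reg => //].
- by split=> //; rewrite take0 big_nil.
Qed.

Lemma runs_update st :
  reg st rOutLen <= t -> reg st rSum < B ->
  runs B inp false 0 update_prog st (6 + (t * (wp_time copy_body + 4) + 3))
    (fun st' =>
      frame [:: rT0; rT1; rJ; rFlag; rCopy; rBestCost;
        rBestLen] [:: aBest] st st' /\
      if reg st rSum < reg st rBestCost
      then [/\ reg st' rBestCost = reg st rSum,
        reg st' rBestLen = reg st rOutLen &
               mkseq (arr st' aBest) (reg st' rBestLen) =
               mkseq (arr st aOut) (reg st rOutLen)]
      else [/\ reg st' rBestCost = reg st rBestCost,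
               reg st' rBestLen = reg st rBestLen &
               arr st' aBest =1 arr st aBest]).
Proof.
move=> hl hS.
have B1 := one_lt_B.
case: fits => f1 f2 f3 f4 f5 f6 f7 f8 f9 f10 f11 f12.
set c := reg st rSum < reg st rBestCost.
pose Q1 st' := frame [:: rT0; rT1; rJ; rFlag; rCopy; rBestCost;
  rBestLen] [:: aBest] st st' /\
  [/\ reg st' rCopy = c * reg st rOutLen,
      reg st' rBestCost = (if c then reg st rSum else reg st rBestCost) &
      reg st' rBestLen = (if c then reg st rOutLen else reg st rBestLen)].
have cl : c * reg st rOutLen <= t by case: (c); lia.
apply: (@runs_seql _ _ _ _ _ _ _ _ _ (fun st' => Q1 st' /\ arr st' = arr st)).
  apply: (@runs_wp _ _ (seqs _)); rewrite /= /upd /= -/c.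
  split; first exact: leq_ltn_trans (leq_b1 _) B1.
  split; first by lia.
  split=> hc.
    have ct : c by move: hc; case: (c).
    split; first by lia.
    rewrite !addn0; split=> //; split; first by lia.
    split=> //; split; first by do ?[apply: frame_reg => //].
    by rewrite /= /upd /= ct.
  have cf : c = false by move: hc; case: (c).
  split=> //; split; first by do ?[apply: frame_reg => //].
  by rewrite /= /upd /= cf.
move=> st1 [[fr1 [c1 c2 c3]] ea].
pose Inv j st' := Q1 st' /\
  ((forall i, i < j -> arr st' aBest i = arr st aOut i) /\
   (forall i, j <= i -> arr st' aBest i = arr st aBest i)).
apply: (@runs_weaken _ _ _ 0 _ _ _ (c * reg st rOutLen * (wp_time copy_body +
  4) + 3) _ (Inv (c * reg st rOutLen))) => //; last first.
- move=> st' [[h1 [h2 h3 h4]] [h5 h6]]; split=> //.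
  move: h3 h4 h5 h6; case: (c) => h3 h4 h5 h6; split=> //.
    by rewrite h4; apply/eq_in_map => i; rewrite mem_iota => /andP[_ hi];
      apply: h5; rewrite mul1n.
  by move=> i; rewrite h6.
- by rewrite leq_add2r leq_mul2r cl orbT.
apply: runs_for => //.
- by apply: leq_ltn_trans cl _; lia.
- by move=> j st' v [[h1 [h2 h3 h4]] [h5 h6]]; split=> //; split=> //;
    exact: frame_reg.
- by move=> j st' v [[h1 [h2 h3 h4]] [h5 h6]]; split=> //; split=> //;
    exact: frame_reg.
- move=> j st' jc [[h1 [h2 h3 h4]] [h5 h6]] hJ hN /=.
  have [_ q2 _] := h1.
  rewrite /upd /= hJ q2 //; split=> //; split; first split.
  + by apply: frame_arr => //; exact: frame_reg.
  + by [].
  + rewrite /= /upd /=; split=> i.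
      by rewrite ltnS leq_eqVlt; case: eqP => [->//|_] /=; exact: h5.
    by move=> hi; rewrite ifF; [apply: h6; lia | apply/negbTE; lia].
- by split=> //; rewrite ea.
Qed.

Lemma runs_emit st l :
  out st = [::] -> mkseq (arr st aBest) (reg st rBestLen) = l ->
  reg st rBestLen <= t ->
  runs B inp false 0 (For rBestLen emit_body) st
    (t * (wp_time emit_body + 4) + 3) (fun st' => out st' = l).
Proof.
move=> ho <- hl.
case: fits => f1 f2 f3 f4 f5 f6 f7 f8 f9 f10 f11 f12.
pose Inv j st' := arr st' aBest = arr st aBest /\
  out st' = mkseq (arr st aBest) j.
apply: (@runs_weaken _ _ _ 0 _ _ _ (reg st rBestLen * (wp_time emit_body + 4) +
  3) _ (Inv (reg st rBestLen))) => //; last first.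
- by move=> st' [].
- by rewrite leq_add2r leq_mul2r hl orbT.
apply: runs_for => //.
- exact: one_lt_B.
- by lia.
- move=> j st' jl [h1 h2] hJ hN /=; rewrite /upd /= hJ; split=> //; split=> //=.
  by rewrite h1 h2 mkseqS.
Qed.
End Scaling.

(** * The rounds of the scaling program *)

Section Rounds.
Variables (phi : problem) (I : instance) (eps : rat) (A : prog).
Variables (B BA t : nat) (Good : nat -> Prop).

Let n := #|` univ I|.
Let W := maxw I.
Let inp := input_of I eps.

Hypothesis phi_wf : well_formed phi.
Hypothesis validI : valid I.
Hypothesis fits : words_fit I eps B t.
Hypothesis BAB : BA <= B.
Hypothesis Good_le : forall c d, c <= d -> Good d -> Good c.

(** With [b] false this is what A guarantees on every tape, a feasible answer; with [b] true it is
    the guarantee of the right round, [Good] standing for the ratio measured in original weights. *)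
Definition answers (b : bool) (g L : nat) : Prop :=
  on_coins b L (fun r => exists2 F,
    exists2 o, outputs BA (input_of (scaled I eps g) eps) A t r o & encodes o F
      &
    feasible phi I F /\ (b -> Good (cost I F))).

Lemma runs_simulate b g L st :
  answers b g L ->
  simulates (reg_bound A) g (input_of (scaled I eps g) eps) init_state st ->
  runs B inp b L (simulate A) st (4 * t) (fun st' =>
    sim_frame g st st' /\ exists F,
      [/\ encodes (mkseq (arr st' aOut) (reg st' rOutLen)) F,
          reg st' rOutLen <= t, feasible phi I F & b -> Good (cost I F)]).
Proof.
move=> hA hs; apply: on_coins_le hA => r _.
move=> [F [ol [bs [rest [u [st' [-> ut hex <-]]]]] he] [hF hG]].
have f12 := fit_time fits.
have hinp f : f != 0 -> f != 2 ->
    nth [::] inp f = nth [::] (input_of (scaled I eps g) eps) f.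
  by case: f => [|[|[|f]]].
have [|v [st2 [a1 a2 a3 a4]]] :=
  simulate_exec BAB (one_lt_B fits) hinp hex (leqnn _) _ hs.
  by rewrite /=; lia.
exists bs, rest, v, st2; split=> //; first by lia.
split=> //; exists F; case: a3 => _ _ e3 _ _; split=> //; first by rewrite -e3.
by have := exec_out_size hex; rewrite e3 size_mkseq /=; lia.
Qed.

Definition best_found (st : state) : Prop := exists F,
  [/\ feasible phi I F, encodes (mkseq (arr st aBest) (reg st rBestLen)) F,
      reg st rBestCost = cost I F & reg st rBestLen <= t].

(** All stamps are below the present guess, so the arrays of the simulated program read as 0. Before
    round 0 no answer is stored. [h] tells whether the probable round lies behind. *)
Definition round_inv (h : bool) (j : nat) (st : state) : Prop :=
  [/\ ready I eps st,
      reg st rGuess = 2 ^ j /\ reg st rMore = (2 ^ j < n * W + 2),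
      forall c y, arr st (aStamp c) y < 2 ^ j,
      (if j is 0 then reg st rBestCost = n * W + 1 else best_found st) &
      h -> Good (reg st rBestCost)].

Lemma cost_encoding (q : seq nat) (F : solution) :
  uniq q -> q =i F.1 -> cost I F = \sum_(e <- q) weight I e.
Proof.
move=> uq eq; rewrite /cost; apply: perm_big; apply: uniq_perm => //.
Qed.

Lemma encoding_sub (q : seq nat) (F : solution) : feasible phi I F ->
  q =i F.1 -> {subset q <= univ I}.
Proof. by move=> /phi_wf /fsubsetP h eq e; rewrite eq; exact: h. Qed.

Definition round_time : nat :=
  (n * (wp_time scale_body + 4) + 3 + (reg_bound A).+1) +
  (4 * t + (3 + (t * (wp_time cost_body + 4) + 3) +
    (6 + (t * (wp_time copy_body + 4) + 3) + wp_time next_prog))).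

Lemma runs_round b h j L st :
  2 ^ j < n * W + 2 -> answers b (2 ^ j) L -> round_inv h j st ->
  runs B inp b L (round_prog A) st round_time (round_inv (h || b) j.+1).
Proof.
move=> jl hA [rd [hg hm] hst hb hG].
set g := 2 ^ j in hg hm hst hA jl *.
have g0 : 0 < g by rewrite expn_gt0.
have g2 : 2 ^ j.+1 = g + g by rewrite expnS mul2n addnn.
have f10 := fit_lim fits; rewrite -/n -/W in f10.
have f12 := fit_time fits.
pose Q1 st1 := 
  [/\ forall x, 5 < x < 20 -> reg st1 x = reg st x,
      forall c, c != aScaled -> arr st1 c = arr st c,
      out st1 = [::], 
      simulates (reg_bound A) g (input_of (scaled I eps g) eps) init_state st1 &
      arr st1 aScaled =1 nth 0 (map (scaled_weight I eps g) (sort leq (univ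
        I)))].
apply: (runs_seql (Q1 := Q1)).
  apply: runs_seql; first by apply: (runs_scale validI fits rd hg); rewrite g0.
  move=> st1 [[h1 h2 h3] h4]; rewrite -reset_time; apply: runs_wp.
  apply: (reset_wp fits) => st2 [k1 k2 k3 k4 k5]; split.
  - by move=> x hx; rewrite k1 ?h1 ?inE //; lia.
  - by move=> c hc; rewrite k2 h2 // inE.
  - by rewrite k3 h3 (ready_out rd).
  - split=> //.
    + by move=> c y; rewrite k2 h2 ?(ltn_eqF (hst c y)) // /aStamp !addnS.
    + by rewrite k4.
    + by rewrite k1 // h1.
    + split=> y; rewrite k2 ?h4 // h2 //; exact: (ready_head rd).
  - by move=> y; rewrite k2 h4.
move=> st1 [h1 h2 h3 h4 h5].
apply: runs_seqr; first exact: (runs_simulate hA h4).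
move=> st2 [[k1 k2 k3 k4] [F [hE hL hF hGF]]].
have [q [uq eq eo]] := hE.
have sq := encoding_sub hF eq.
have rd2 : ready I eps st2.
  case: rd => r1 r2 r3 r4 r5 r6 r7 r8 r9.
  split; rewrite ?k1 ?h1 //.
  - by move=> y; rewrite k2 // h2.
  - by move=> e he; rewrite k2 // h2 // r7.
  - by move=> y hy; rewrite k2 // h5 nth_default // size_map size_sort.
  - by rewrite k3.
apply: (runs_seql (runs_cost validI fits eo uq sq rd2 hL)).
move=> st3 [[l1 l2 l3] l4].
rewrite -(cost_encoding uq eq) in l4.
have hcost : cost I F <= n * W.
  by rewrite (cost_encoding uq eq); exact: sum_weight_le.
apply: runs_seql.
  apply: (runs_update fits); first by rewrite l1.
  by rewrite l4; lia.
move=> st4 [[m1 m2 m3] m4]; apply: runs_wp.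
have eg : reg st4 rGuess = g by rewrite m1 // l1 // k1 //; case: h4.
have el : reg st4 rLim = n * W + 2 by rewrite m1 // l1 // (ready_lim rd2).
rewrite /next_prog /= /upd /= eg el.
split; first by lia.
split; first exact: leq_ltn_trans (leq_b1 _) (one_lt_B fits).
have ebc : reg st3 rBestCost = reg st rBestCost by rewrite l1 // k1 // h1.
have ebl : reg st3 rBestLen = reg st rBestLen by rewrite l1 // k1 // h1.
have eol : reg st3 rOutLen = reg st2 rOutLen by rewrite l1.
split.
- case: rd2 => r1 r2 r3 r4 r5 r6 r7 r8 r9.
  split; rewrite /= /upd /= ?m1 ?l1 ?m3 ?l3 //.
  + by move=> y; rewrite m2 // l2.
  + by move=> e he; rewrite m2 // l2 // r7.
  + by move=> y hy; rewrite m2 // l2 // r8.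
- by rewrite /= /upd /= g2.
- move=> c y; rewrite /= m2 ?l2 //; last by rewrite /aStamp !addnS.
  rewrite g2; case: (k4 c y) => ->; last by lia.
  rewrite h2 ?/aStamp ?addnS //; have := hst c y; rewrite /aStamp ?addnS; lia.
- move: m4; rewrite l4 ebc; case: ltnP => hc [n1 n2 n3].
    exists F; rewrite /= /upd /=; split=> //; last by rewrite n2 eol.
    by rewrite n3 l2 // eol.
  (* In round 0 rejection is impossible: the cost is at most n W and [rBestCost] is n W + 1. *)
  case: (j) hb => [hb|_ [F' [p1 p2 p3 p4]]]; first by lia.
  exists F'; rewrite /= /upd /= n1 n2 ebl; split=> //.
  have -> // : mkseq (arr st4 4) (reg st 13) = mkseq (arr st 4) (reg st 13).
  by apply: eq_mkseq => i; rewrite n3 l2 // k2 // h2.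
- rewrite /= /upd /=; have le1 : reg st4 rBestCost <= reg st rBestCost /\
    reg st4 rBestCost <= cost I F.
    by move: m4; rewrite l4 ebc; case: ltnP => hc [-> _ _]; split=> //;
      exact: ltnW.
  case/orP => [/hG|/hGF]; apply: Good_le; by case: le1.
Qed.

Let N := up_log 2 (n * W + 2).

Lemma ltn_up_log2 j m : (j < up_log 2 m) = (2 ^ j < m).
Proof.
apply/idP/idP => h; rewrite ltnNge; apply/negP => h2.
  by have := up_log_min (p := 2) isT h2; rewrite leqNgt h.
have := leq_trans h (up_logP m (isT : 1 < 2)).
by rewrite ltn_exp2l // ltnNge h2.
Qed.

Definition scaling_time : nat :=
  wp_time setup_consts + (n * (wp_time table_body + 4) + 3) +
  ((N * round_time.+1).+1 + (t * (wp_time emit_body + 4) + 3)).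

(** Used twice: with [b] false for feasibility on every tape, and with [b] true for the
    approximation, [k] being the round of the right guess. *)
Lemma runs_scaling (b : bool) k L :
  (forall j, j < N -> answers false (2 ^ j) L) ->
  (b -> k < N /\ answers true (2 ^ k) L) ->
  runs B inp b (N * L) (scaling_prog A) init_state scaling_time (fun st =>
    exists F, [/\ encodes (out st) F, feasible phi I F & b -> Good (cost I F)]).
Proof.
move=> hA hT; apply: runs_seql; first exact: (runs_setup validI fits).
move=> st1 [rd [g1 c1 m1] s1].
have N0 : 0 < N by rewrite ltn_up_log2 -/n -/W addn2.
have inv0 : round_inv false 0 st1.
  by split=> //; [rewrite g1 m1 addn2 | move=> c y; rewrite s1].
have stop h st : round_inv h N st -> reg st rMore = 0.
  case=> _ [_ ->] _ _ _; apply/eqP; rewrite eqb0 -leqNgt; exact: up_logP.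
have step h j st : j < N -> round_inv h j st ->
    reg st rMore != 0 /\ runs B inp false L (round_prog A) st round_time
      (round_inv h j.+1).
  move=> jN hI; have jl : 2 ^ j < n * W + 2 by rewrite -ltn_up_log2.
  split; first by case: hI => _ [_ ->] _ _ _; rewrite jl.
  by rewrite -[h]orbF; exact: runs_round (hA _ jN) hI.
apply: (runs_seqr (Q1 := round_inv b N)).
  case: b hT => hT.
    have [kN hk] := hT isT.
    apply: (runs_while_once (Inv := round_inv) kN stop step) inv0 => st hI.
    by apply: (runs_round (h := false) _ hk hI); rewrite -ltn_up_log2.
  by apply: (runs_while (stop false) (step false)) inv0.
move=> st2 [rd2 _ _ hb hG].
have [F [f1 f2 f3 f4]] : best_found st2 by case: (N) N0 hb.
apply: (@runs_weaken _ _ _ 0 _ _ _ _ _ _ _ (runs_emit fits (ready_out rd2)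
  erefl f4)) => //.
by move=> st3 ->; exists F; split=> //; rewrite -f3.
Qed.
End Rounds.

(** * Approximation ratio, word size and number of steps *)

Import Order.TTheory GRing.Theory Num.Theory.

Lemma eps_fraction (eps : rat) : (0 < eps < 1)%R ->
  [/\ 0 < `|numq eps|, `|numq eps| < `|denq eps| &
      (eps * (`|denq eps|)%:R = (`|numq eps|)%:R)%R].
Proof.
move=> /andP[e0 e1].
have n0 : (0 < numq eps)%R by rewrite numq_gt0.
have d0 := denq_gt0 eps.
have d0' : (0 < (denq eps)%:~R :> rat)%R by rewrite ltr0z.
have en : ((`|numq eps|)%:R = (numq eps)%:~R :> rat)%R.
  by rewrite -[in RHS](gtz0_abs n0).
have ed : ((`|denq eps|)%:R = (denq eps)%:~R :> rat)%R.
  by rewrite -[in RHS](gtz0_abs d0).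
have eq : (eps * (`|denq eps|)%:R = (`|numq eps|)%:R)%R.
  by rewrite en ed -[X in (X * _ = _)%R]divq_num_den divfK ?gt_eqF.
split=> //; first by rewrite absz_gt0 gt_eqF.
rewrite -(ltr_nat rat) -eq -[ltRHS]mul1r ltr_pM2r ?ed //.
Qed.

Section Approximation.
Variables (phi : problem) (I : instance) (eps : rat) (g : nat).
Hypothesis phi_wf : well_formed phi.
Hypothesis validI : valid I.
Hypothesis eps01 : (0 < eps < 1)%R.
Hypothesis g0 : 0 < g.

Let n := #|` univ I|.
Let a := `|numq eps|%N.
Let b := `|denq eps|%N.
Let J := scaled I eps g.

Lemma scaled_valid : valid J.
Proof. by split=> // e _; rewrite /= scaled_bound. Qed.

Lemma card_solution F : feasible phi I F -> size F.1 <= n.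
Proof.
by move=> /phi_wf /fsubsetP h; apply: uniq_leq_size => //; exact: fset_uniq.
Qed.

(** Truncation only lowers a weight, and rounding up adds at most 1 per element, which is the term
    [a * g] after clearing denominators. *)
Lemma scaled_cost_le F : feasible phi I F ->
  a * g * cost J F <= n * b * cost I F + a * g * size F.1.
Proof.
move=> hF; rewrite /cost !big_distrr /= -sum1_size big_distrr -big_split /=.
apply: leq_sum => e _; rewrite muln1 /scaled_weight mulnS addnC leq_add2r.
apply: leq_trans (_ : a * g * (weight I e * (n * b) %/ (a * g)) <= _).
  by rewrite leq_mul2l geq_minl orbT.
by rewrite mulnC [leqRHS]mulnC leq_trunc_div.
Qed.

Lemma size_cost_le F : feasible phi I F -> size F.1 <= cost I F.
Proof.
move=> /phi_wf /fsubsetP h; rewrite /cost -sum1_size big_seq [leqRHS]big_seq.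
by apply: leq_sum => e /h he; case: validI => _ /(_ e he) /andP[].
Qed.

Lemma size_scaled_cost_le (F : solution) : size F.1 <= cost J F.
Proof. by rewrite /cost -sum1_size; apply: leq_sum. Qed.

(** A single truncated element costs [cap + 1], which already exceeds 6 n b / a, so the hypothesis
    excludes truncation; without it, rounding up never undercounts a weight. *)
Lemma cost_le_scaled (F : solution) : a * cost J F <= 6 * (n * b) ->
  n * b * cost I F <= a * g * cost J F.
Proof.
have [a0 _ _] := eps_fraction eps01; rewrite -/a in a0.
move=> h; rewrite /cost !big_distrr big_seq [leqRHS]big_seq.
apply: leq_sum => e he; rewrite -[weight J e]/(scaled_weight I eps g e).
have le1 : scaled_weight I eps g e <= cost J F.
  by rewrite /cost (big_rem e) //= leq_addr.
rewrite /scaled_weight in le1 *.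
have h6 := ltn_ceil (6 * (n * b)) a0.
case: (leqP (cap I eps) (weight I e * (n * b) %/ (a * g))) => hc.
  move: le1; rewrite -/n -/b -/a (minn_idPr hc) => le1.
  have : a * (cap I eps).+1 <= a * cost J F by rewrite leq_mul2l le1 orbT.
  rewrite /cap -/n -/a -/b; move: h6 h; rewrite mulnC; lia.
have agp : 0 < a * g by rewrite muln_gt0 a0.
have := ltn_ceil (weight I e * (n * b)) agp; rewrite /=; nia.
Qed.

(* In the main case [g <= o < 2 g], an answer that is near-optimal for the
   scaled weights uses no truncated element, so undoing the scaling costs at
   most [n] rounding errors of size [eps g / n] each. *)
Lemma scaled_approx o F :
  is_opt phi I o -> o = 0 \/ g <= o < 2 * g ->
  approx_solution phi J eps F ->
  ((cost I F)%:R <= (1 + 3 * eps) * o%:R)%R.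
Proof.
move=> [[F0 hF0 c0] omin] ho [hF [ o' [[F1 hF1 c1] o'min] hle]].
have [a0 ab eqe] := eps_fraction eps01; rewrite -/a -/b in a0 ab eqe.
have b0 : 0 < b by exact: leq_ltn_trans ab.
have hle' : b * cost J F <= (a + b) * o'.
  rewrite -(ler_nat rat) !natrM natrD -eqe.
  have : (b%:R * (cost J F)%:R <= b%:R * ((1 + eps) * o'%:R) :> rat)%R.
    by rewrite ler_pM2l ?ltr0n.
  by rewrite mulrA mulrDr mulr1 [(b%:R * eps)%R]mulrC addrC.
have ho' : o' <= cost J F0 by exact: o'min.
have hs := scaled_cost_le hF0; rewrite c0 in hs.
have hn := card_solution hF0.
have ho0 : size F0.1 <= o by rewrite -c0; exact: size_cost_le.
suff H : b * cost I F <= (b + 3 * a) * o.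
  have : (b%:R * (cost I F)%:R <= b%:R * ((1 + 3 * eps) * o%:R) :> rat)%R.
    have -> : (b%:R * ((1 + 3 * eps) * o%:R) = ((b + 3 * a) * o)%:R :> rat)%R.
      rewrite natrM natrD natrM -eqe mulrA; congr (_ * _)%R.
      by rewrite mulrDr mulr1 mulrCA [(b%:R * eps)%R]mulrC.
    by rewrite -natrM ler_nat.
  by rewrite ler_pM2l ?ltr0n.
have ag0 : 0 < a * g by rewrite muln_gt0 a0.
have small : cost J F = 0 -> cost I F = 0.
  move=> h; have : size F.1 <= 0 by rewrite -h size_scaled_cost_le.
  by rewrite leqn0 size_eq0 => /eqP hF2; rewrite /cost hF2 big_nil.
(* If the optimum is 0, positive weights force an empty optimal set; then the scaled optimum is 0
   too and the answer must be empty, whatever the guess. *)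
case: ho => [ o0|/andP[go og]].
  suff -> : cost I F = 0 by rewrite muln0.
  apply: small; apply/eqP; rewrite -leqn0 -(leq_pmul2l b0).
  apply: leq_trans hle' _.
  have -> : o' = 0; last by rewrite muln0.
  apply/eqP; rewrite -leqn0 -(leq_pmul2l ag0).
  apply: leq_trans (leq_mul (leqnn _) ho') _.
  apply: leq_trans hs _; rewrite o0 muln0 add0n.
  by rewrite leq_mul2l; apply/orP; right; rewrite o0 in ho0.
have [n0|n0] := posnP n.
  have -> : cost I F = 0; last by rewrite muln0.
  have := card_solution hF; rewrite n0 leqn0 size_eq0.
  by move=> /eqP hF2; rewrite /cost hF2 big_nil.
have key : a * g * (b * cost J F) <= (a + b) * (n * b * o + a * g * n).
  apply: leq_trans (leq_mul (leqnn _) hle') _.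
  rewrite mulnCA leq_mul2l; apply/orP; right.
  apply: leq_trans (leq_mul (leqnn _) ho') _.
  apply: leq_trans hs _; rewrite leq_add2l leq_mul2l hn orbT //.
(* Origin of the constant 6: with o < 2 g and a < b, the optimum with its rounding errors is at most
   3 n b g after clearing denominators, and the ratio 1 + eps contributes a factor of at most 2. *)
have cap_ok : a * cost J F <= 6 * (n * b).
  have bg0 : 0 < b * g by rewrite muln_gt0 b0.
  rewrite -(leq_pmul2l bg0).
  have -> : b * g * (a * cost J F) = a * g * (b * cost J F) by nia.
  apply: leq_trans key _.
  have s1 : n * b * o + a * g * n <= 3 * (n * b * g).
    have : n * b * o <= n * b * (2 * g) by rewrite leq_mul2l ltnW ?orbT.
    have : a * (g * n) <= b * (g * n) by rewrite leq_mul2r ltnW ?orbT.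
    nia.
  apply: leq_trans (leq_mul (_ : a + b <= 2 * b) s1) _; first by lia.
  nia.
have fin := cost_le_scaled cap_ok.
have s2 : n * b * (b * cost I F) <= (a + b) * (n * b * o + a * o * n).
  apply: leq_trans (_ : a * g * (b * cost J F) <= _).
    by rewrite mulnCA [leqRHS]mulnCA leq_mul2l fin orbT.
  apply: leq_trans key _; rewrite leq_mul2l leq_add2l leq_mul2r leq_mul2l go
    !orbT //.
have s3 : (a + b) * (n * b * o + a * o * n) <= n * b * ((b + 3 * a) * o).
  have -> : (a + b) * (n * b * o + a * o * n) = n * o * ((a + b) * (a + b)) by
    nia.
  have -> : n * b * ((b + 3 * a) * o) = n * o * (b * (b + 3 * a)) by nia.
  rewrite leq_mul2l; apply/orP; right.
  have : a * a <= a * b by rewrite leq_mul2l ltnW ?orbT.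
  nia.
have nb0 : 0 < n * b by rewrite muln_gt0 n0.
by rewrite -(leq_pmul2l nb0); exact: leq_trans s2 s3.
Qed.
End Approximation.

(** * Polynomial bounds on the numbers that occur *)

Section WordSize.
Variables (I : instance) (eps : rat).
Hypothesis validI : valid I.
Hypothesis eps01 : (0 < eps < 1)%R.
Let n := #|` univ I|.
Let W := maxw I.
Let a := `|numq eps|%N.
Let b := `|denq eps|%N.
Let M := magnitude (input_of I eps).

Lemma lt_magnitude inp x : x \in flatten inp -> x.+1 < magnitude inp.
Proof. by move=> h; rewrite /magnitude !ltnS;
  exact: (leq_bigmax_seq (F := id)). Qed.

Lemma magnitude_le inp X :
  (forall x, x \in flatten inp -> x <= X) -> magnitude inp <= X.+2.
Proof. by move=> h; rewrite /magnitude !ltnS;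
  apply/bigmax_leqP_seq => x /h. Qed.

Lemma input_lt_magnitude :
  [/\ [/\ n.+1 < M, (size (str I)).+1 < M, W.+1 < M, a.+1 < M & b.+1 < M],
      forall e, e \in univ I -> e.+1 < M & 1 < M].
Proof.
split=> //; last first.
  move=> e he; apply: lt_magnitude;
    rewrite /input_of /= !inE !mem_cat mem_sort he.
  by rewrite !orbT.
by split; apply: lt_magnitude; rewrite /input_of /= !inE eqxx ?orbT.
Qed.

(** The new largest weight, about 6 n / eps, is quadratic in the input words since 1 / eps is at
    most the denominator of [eps]. *)
Lemma magnitude_scaled g :
  magnitude (input_of (scaled I eps g) eps) <= 8 * (M * M).
Proof.
have [[h1 h2 h3 h4 h5] h6 h7] := input_lt_magnitude.
have hc : (cap I eps).+1 <= 6 * (M * M).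
  apply: (@leq_trans (6 * (n * b)).+1); first by rewrite ltnS leq_div.
  have : n.+1 * b.+1 <= M * M by apply: leq_mul; exact: ltnW.
  rewrite -/n -/b; nia.
have hM : M + 2 <= 2 * (M * M) by nia.
have hM6 : 6 * (M * M) + 2 <= 8 * (M * M) by nia.
apply: leq_trans (magnitude_le (X := 6 * (M * M)) _) _; last by lia.
have big x : x.+1 < M -> x <= 6 * (M * M) by lia.
move=> x; rewrite /input_of /= !inE !mem_cat mem_sort ?in_nil ?orbF.
do 5![case/orP; first by move=> /eqP ->; solve [exact: hc | exact: big]].
case/orP => [/h6/big //|].
case/orP => [/mapP[e _ ->]|/mapP[c _ ->]].
  exact: leq_trans (scaled_bound _ _ _ _) hc.
by case: c; lia.
Qed.

(** The quantities to bound are products of at most three input words up to small constants, hence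
    within 8 Z^3, and 8 <= Z^3. The free [k] leaves room for the words of the simulated program. *)
Lemma words_fit_pow Z t k : M <= Z -> t < Z -> words_fit I eps (Z ^ (k + 6)) t.
Proof.
move=> MZ tZ.
have [[h1 h2 h3 h4 h5] h6 h7] := input_lt_magnitude.
have hZ : 8 * (Z * (Z * Z)) <= Z ^ (k + 6).
  apply: (@leq_trans (Z ^ 6)); last by rewrite leq_pexp2l ?leq_addl //; lia.
  have -> : Z ^ 6 = (Z * (Z * Z)) * (Z * (Z * Z)) by rewrite !expnS; nia.
  rewrite leq_mul2r; apply/orP; right.
  by apply: (@leq_trans (2 * (2 * 2))) => //; do 2?apply: leq_mul; lia.
set Y := Z ^ _ in hZ *.
have Z2 : 2 <= Z by lia.
have zz : 2 * Z <= Z * Z by rewrite leq_mul2r Z2 orbT.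
have zzz : 2 * (Z * Z) <= Z * (Z * Z) by rewrite leq_mul2r Z2 orbT.
have hnb : n.+1 * b.+1 <= Z * Z by apply: leq_mul; lia.
have hnW : n.+1 * W.+1 <= Z * Z by apply: leq_mul; lia.
have q1 : W.+1 * (n.+1 * b.+1) <= Z * (Z * Z) by apply: leq_mul => //; lia.
have q2 : a.+1 * (n.+1 * W.+1) <= Z * (Z * Z) by apply: leq_mul => //; lia.
have hn1 : n * b <= n.+1 * b.+1 by apply: leq_mul.
have hn2 : n * W <= n.+1 * W.+1 by apply: leq_mul.
have q1' : W * (n * b) <= W.+1 * (n.+1 * b.+1) by apply: leq_mul.
have q2' : a * (n * W) <= a.+1 * (n.+1 * W.+1) by apply: leq_mul => //.
split; rewrite -/n -/W -/a -/b; try lia.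
by move=> e /h6; lia.
Qed.
End WordSize.

(** The setup and the final output are absorbed because there is at least one round; 200 leaves room
    for the instruction counts of the fixed code. *)
Lemma scaling_time_le I A t :
  scaling_time I A t <=
  (reg_bound A + 200) * (up_log 2 (#|` univ I| * maxw I + 2) * (t + #|` univ I|
    + 1)).
Proof.
set n := #|` univ I|; set m := reg_bound A.
have N0 : 0 < up_log 2 (n * maxw I + 2) by rewrite ltn_up_log2 addn2.
rewrite /scaling_time -/n; move: N0; set N := up_log _ _ => N0.
set X := t + n + 1.
have hX : X <= N * X by rewrite leq_pmull.
have hm : m <= m * X by rewrite leq_pmulr // /X addn1.
have hr : (round_time I A t).+1 <= (m + 100) * X.
  by rewrite mulnDl /round_time -/n -/m /=; rewrite /X in hm *; lia.
have : N * (round_time I A t).+1 <= N * ((m + 100) * X) by rewrite leq_mul2l hr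
  orbT.
have -> : (m + 200) * (N * X) = N * ((m + 100) * X) + 100 * (N * X) by nia.
rewrite /=; move: (N * _.+1) (N * (_ * _)) (N * X) hX; rewrite /X; lia.
Qed.

(** * Time bound and the theorem *)

Lemma exec_le B B' inp p st t bs st' :
  B <= B' -> exec B inp p st t bs st' -> exec B' inp p st t bs st'.
Proof.
move=> BB'; elim.
- by move=> *; exact: ExecSkip.
- by move=> *; apply: ExecConst; apply: leq_trans BB'.
- by move=> *; apply: ExecOp; apply: leq_trans BB'.
- by move=> *; exact: ExecFetch.
- by move=> *; exact: ExecStore.
- by move=> *; apply: ExecInput; apply: leq_trans BB'.
- by move=> *; apply: ExecRand => //; apply: leq_trans BB'.
- by move=> *; exact: ExecOutput.
- by move=> *; apply: ExecSeq; eassumption.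
- by move=> *; exact: ExecIfT.
- by move=> *; exact: ExecIfF.
- by move=> *; apply: ExecWhileT; eassumption.
- by move=> *; exact: ExecWhileF.
Qed.

Lemma outputs_le B B' inp p t t' r o :
  B <= B' -> t <= t' -> outputs B inp p t r o -> outputs B' inp p t' r o.
Proof.
move=> BB' tt' [bs [rest [u [st [-> ut e1 e2]]]]]; exists bs, rest, u, st.
by split=> //; [exact: leq_trans tt' | exact: exec_le e1].
Qed.

Lemma outputs_cat B inp p t r s o :
  outputs B inp p t r o -> outputs B inp p t (r ++ s) o.
Proof.
move=> [bs [rest [u [st [-> ut e1 e2]]]]]; exists bs, (rest ++ s), u, st.
by rewrite catA.
Qed.

Lemma exec_time_gt0 B inp p st t bs st' : exec B inp p st t bs st' -> 0 < t.
Proof. by elim=> // *; rewrite addn_gt0; apply/orP; left. Qed.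

Lemma half_le_Pr L (E : seq bool -> Prop) :
  (1 / 2 <= Pr (fun r : L.-tuple bool =>
    E r))%R = (2 ^ L <= 2 * count_bits L E).
Proof.
rewrite /Pr card_count_bits.
rewrite ler_pdivlMr ?ltr0n ?expn_gt0 // mul1r ler_pdivrMl // -natrM ler_nat.
by [].
Qed.

Section RealBound.
Local Open Scope ring_scope.
Variable R : realType.

(** The factor 2 / ln 2 converts the number of rounds to a natural logarithm. In the last factor,
    4^k comes from [shifted_ln_cap], (ln 2)^-k from inserting the logarithmic factor next to n, and
    2 from t + n + 1 <= 2 (t + n). *)
Definition scaling_constant (C : R) (k c0 : nat) : R :=
  c0%:R * (2 / ln 2) * (2 * (C * 4 ^+ k + (ln 2)^-1 ^+ k)).

Lemma ln2_gt0 : 0 < ln 2 :> R. Proof. by rewrite ln_gt0 // ltr1n. Qed.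

Lemma scaling_constant_gt0 C k c0 :
  0 < C -> (0 < c0)%N -> 0 < scaling_constant C k c0.
Proof.
move=> C0 c00; have l2 := ln2_gt0.
rewrite !mulr_gt0 ?ltr0n ?invr_gt0 //.
by rewrite addr_gt0 ?mulr_gt0 ?exprn_gt0 ?invr_gt0.
Qed.

Lemma shifted_ln_ge (x : R) : 0 <= x -> ln 2 <= shifted_ln x.
Proof.
by move=> x0; rewrite /shifted_ln ler_ln ?posrE //; lra.
Qed.

(** The rounded-up logarithm exceeds log2(m + 2) by less than 1, and 1 is at most log2(m + 2),
    whence the factor 2. *)
Lemma up_log_le m : (up_log 2 (m + 2))%:R <= 2 / ln 2 * shifted_ln m%:R :> R.
Proof.
have l2 := ln2_gt0.
have h1 : (1 < m + 2)%N by rewrite addn2.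
have := up_log_gtn (isT : (1 < 2)%N) h1.
have N0 : (0 < up_log 2 (m + 2))%N by rewrite ltn_up_log2 addn2.
move: N0; set N := up_log _ _ => N0; rewrite -(ltr_nat R) natrX natrD => h.
have hm : 0 <= m%:R :> R by rewrite ler0n.
have lm := shifted_ln_ge hm.
have : ln (2 ^+ N.-1) <= shifted_ln m%:R :> R.
  rewrite /shifted_ln ler_ln ?posrE ?exprn_gt0 //; first exact: ltW.
have -> : N%:R = N.-1%:R + 1 :> R by rewrite natr1 prednK.
rewrite lnXn // -[X in X <= _ -> _]mulr_natr => h2.
have -> : 2 / ln 2 * shifted_ln m%:R = (shifted_ln m%:R + shifted_ln m%:R) / ln
  2 :> R.
  by ring.
rewrite ler_pdivlMr //.
by rewrite mulrDl mul1r mulrC lerD.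
Qed.

(** With x = n / eps, cap + 3 <= 6 x + 3 <= (x + 2)^4, whence the factor 4. *)
Lemma shifted_ln_cap (I : instance) (eps : rat) : 0 < eps < 1 ->
  shifted_ln (cap I eps).+1%:R <=
  4 * shifted_ln (#|` univ I|%:R / ratr eps) :> R.
Proof.
move=> e01; have [a0 ab eqe] := eps_fraction e01.
have er0 : 0 < ratr eps :> R by rewrite ltr0q; case/andP: e01.
set n := #|` univ I|.
set x := n%:R / ratr eps.
have x0 : 0 <= x by rewrite divr_ge0 ?ler0n // ltW.
have hcap : (cap I eps)%:R <= 6 * x.
  have a0R : 0 < `|numq eps|%N%:R :> R by rewrite ltr0n.
  rewrite -(ler_pM2r a0R) -natrM.
  have : (cap I eps * `|numq eps| <= 6 * (n * `|denq eps|))%N by exact: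
    leq_trunc_div.
  rewrite -(ler_nat R) => /le_trans; apply.
  have -> : `|numq eps|%N%:R = ratr eps * `|denq eps|%N%:R :> R.
    by rewrite -[LHS](ratr_nat R) -eqe rmorphM /= ratr_nat.
  rewrite /x !natrM le_eqVlt; apply/orP; left; apply/eqP.
  by field; rewrite gt_eqF.
rewrite /shifted_ln mulr_natl -lnXn; last by lra.
rewrite ler_ln ?posrE ?exprn_gt0; try lra.
  by rewrite -natr1; apply: le_trans (_ : 6 * x + 3 <= _); [lra | nra].
by rewrite ltr_wpDl // ler0n.
Qed.

Lemma scaling_time_bound (C T : R) k c0 (I : instance) (eps : rat) t :
  0 < C -> 0 < eps < 1 -> (0 < t)%N ->
  t%:R <= C * (T * shifted_ln (cap I eps).+1%:R ^+ k) ->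
  (c0 * (up_log 2 (#|` univ I| * maxw I + 2) * (t + #|` univ I| + 1)))%:R <=
  scaling_constant C k c0 * ((T + #|` univ I|%:R)
     * shifted_ln (#|` univ I|%:R / ratr eps) ^+ k
     * shifted_ln (maxw I * #|` univ I|)%:R).
Proof.
move=> C0 e01 t0 ht; have l2 := ln2_gt0.
have lcap := @shifted_ln_cap I eps e01.
have er0 : 0 < ratr eps :> R by rewrite ltr0q; case/andP: e01.
set n := #|` univ I| in lcap *.
have x0 : 0 <= n%:R / ratr eps :> R by rewrite divr_ge0 ?ler0n // ltW.
have lx := shifted_ln_ge x0.
have lc : ln 2 <= shifted_ln (cap I eps).+1%:R :> R by apply: shifted_ln_ge;
  rewrite ler0n.
have hN := up_log_le (n * maxw I).
rewrite [(maxw I * n)%N]mulnC.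
move: hN lx lcap lc ht; set N := up_log _ _; set lL := shifted_ln (n * _)%:R.
set lX := shifted_ln (n%:R / _); set lC := shifted_ln _ => hN lx lcap lc ht.
have t1 : 1 <= t%:R :> R by rewrite ler1n.
(* [T] is positive here because at least one step fits within the bound. *)
have T0 : 0 < T.
  have lCk : 0 < lC ^+ k by rewrite exprn_gt0 //; lra.
  have : 0 < C * (T * lC ^+ k) by lra.
  by rewrite pmulr_rgt0 // pmulr_lgt0.
have lX0 : 0 < lX by lra.
have lXk : 0 < lX ^+ k by rewrite exprn_gt0.
have n0 : 0 <= n%:R :> R by rewrite ler0n.
have b1 : t%:R <= C * 4 ^+ k * (T * lX ^+ k).
  apply: le_trans ht _; rewrite -mulrA ler_pM2l // mulrCA ler_pM2l //.
  by rewrite -exprMn lerXn2r ?nnegrE //; lra.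
have b2 : n%:R <= (ln 2)^-1 ^+ k * (n%:R * lX ^+ k).
  rewrite mulrCA ler_peMr // -exprMn exprn_ege1 //.
  by rewrite mulrC ler_pdivlMr // mul1r.
have c4 : 0 <= C * 4 ^+ k by rewrite mulr_ge0 ?exprn_ge0 // ltW.
have cl : 0 <= (ln 2)^-1 ^+ k :> R by rewrite exprn_ge0 // invr_ge0 ltW.
have b3 : (t + n + 1)%:R <= 2 * (C * 4 ^+ k + (ln 2)^-1 ^+ k) * ((T + n%:R) *
  lX ^+ k).
  apply: (@le_trans _ _ (2 * (t%:R + n%:R))); first by rewrite !natrD; lra.
  rewrite -mulrA ler_pM2l //.
  apply: le_trans (lerD b1 b2) _; rewrite !mulrDl !mulrDr.
  have d1 : 0 <= C * 4 ^+ k * (n%:R * lX ^+ k) by rewrite !mulr_ge0 // ltW.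
  have d2 : 0 <= (ln 2)^-1 ^+ k * (T * lX ^+ k) by rewrite !mulr_ge0 // ltW.
  by lra.
rewrite !natrM /scaling_constant -!mulrA ler_wpM2l ?ler0n //.
apply: le_trans (ler_pM _ _ hN b3) _; rewrite ?ler0n //.
rewrite le_eqVlt; apply/orP; left; apply/eqP; ring.
Qed.
End RealBound.

(** A may need a different number of tosses for each guess; only finitely many guesses occur, so the
    largest number serves all. *)
Lemma uniform_coins (P : nat -> nat -> Prop) N :
  (forall j L L', L <= L' -> P j L -> P j L') ->
  (forall j, exists L, P j L) -> exists L, forall j, j < N -> P j L.
Proof.
move=> up ex; elim: N => [|N [L IH]]; first by exists 0.
have [L' hL'] := ex N; exists (maxn L L') => j.
rewrite ltnS leq_eqVlt => /orP[/eqP ->|/IH h].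
  exact: up (leq_maxr L L') hL'.
exact: up (leq_maxl L L') h.
Qed.

Local Open Scope ring_scope.

Theorem theoremB1 (R : realType) (phi : problem) (T : seq bool -> rat -> R)
    (phi_wf : well_formed phi) :
  (exists (A : prog) (C : R) (k : nat),
     0 < C /\
     randomized_approx phi A
       (fun I eps => C * (T (str I) eps * shifted_ln (maxw I)%:R ^+ k))
       (fun eps => eps)) ->
  exists (A' : prog) (C : R) (k : nat) (K : rat),
    0 < C /\ 0 < K /\
    randomized_approx phi A'
      (fun I eps =>
         C * ((T (str I) eps + #|` univ I|%:R)
              * shifted_ln (#|` univ I|%:R / ratr eps) ^+ k
              * shifted_ln (maxw I * #|` univ I|)%:R))
      (fun eps => K * eps).
Proof.
move=> [A [C [k [C0 [c H]]]]].
set c0 := (reg_bound A + 200)%N.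
exists (scaling_prog A), (scaling_constant C k c0), k, 3.
split; first by apply: scaling_constant_gt0 => //; rewrite /c0 addnS.
(* With Z = M + t', the exponent 6 c accommodates the words of A, since 8 M^2 + t <= 16 Z^2 <= Z^6,
   and the other 6 the computations of the scaling program. *)
split=> //; exists (6 * c + 6)%N => I eps vI e01.
set n := #|` univ I|; set M := magnitude (input_of I eps).
set bnd := C * (T (str I) eps * shifted_ln (cap I eps).+1%:R ^+ k).
(* The time bound of A is the same for all guesses; its integer part is a step count common to all
   rounds. *)
set t := Num.truncn bnd; set N := up_log 2 (n * maxw I + 2).
set BA := ((8 * (M * M) + t) ^ c)%N.
pose answered (Q : nat -> solution -> Prop) j r := exists2 F,
  exists2 o, outputs BA (input_of (scaled I eps (2 ^ j)) eps) A t r o & encodes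
    o F &
  Q j F.
pose near j F := approx_solution phi (scaled I eps (2 ^ j)) eps F.
pose feas (j : nat) F := feasible phi I F.
pose P j L := on_coins false L (answered feas j) /\
  on_coins true L (answered near j).
have scaled_run j : [/\ (0 < t)%N, t%:R <= bnd & exists L, P j L].
  have [tj [L [ht hs hp]]] := H (scaled I eps (2 ^ j)) eps (scaled_valid _ _ _)
    e01.
  have bnd0 : 0 <= bnd by apply: le_trans ht; rewrite ler0n.
  have tjt : (tj <= t)%N by rewrite truncn_ge_nat.
  have BAle : ((magnitude (input_of (scaled I eps (2 ^ j)) eps) + tj) ^ c <=
    BA)%N.
    have [c00|cp] := posnP c; first by rewrite /BA c00 !expn0.
    by rewrite leq_exp2r // leq_add // magnitude_scaled.
  have lift (Q : nat -> solution -> Prop) F r : 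
      (exists2 o, outputs ((magnitude (input_of (scaled I eps (2 ^ j)) eps) +
        tj) ^ c)
         (input_of (scaled I eps (2 ^ j)) eps) A tj r o & encodes o F) ->
           Q j F ->
      answered Q j r.
    by move=> [ol ho he] hQ; exists F => //; exists ol => //;
      exact: outputs_le ho.
  split; last exists L.
  - have [F [ol [bs [rest [u [st [_ ut e1 _]]]]] _] _] :=
      hs [tuple of nseq L false].
    exact: leq_trans (leq_trans (exec_time_gt0 e1) ut) tjt.
  - by rewrite truncn_le.
  - split.
      move=> r /eqP sr; have [F hr hF] := hs (Tuple sr); exact: lift hr hF.
    pose E r := exists2 F,
      exists2 o, outputs ((magnitude (input_of (scaled I eps (2 ^ j)) eps) +
        tj) ^ c)
         (input_of (scaled I eps (2 ^ j)) eps) A tj r o & encodes o F & near j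
           F.
    move: hp; rewrite (half_le_Pr L E).
    by apply: (@on_coins_le true) => r _ [F hr hF]; exact: lift hr hF.
have [t0 tb _] := scaled_run 0.
have Pup j L L' : (L <= L')%N -> P j L -> P j L'.
  have up (Q : nat -> solution -> Prop) r s : answered Q j r ->
    answered Q j (r ++ s).
    by move=> [F [ol ho he] hQ]; exists F => //; exists ol => //;
      exact: outputs_cat.
  by move=> LL [h1 h2]; split;
    [apply: on_coins_widen h1|apply: on_coins_widen h2] => //; apply: up.
have [L PL] : exists L, forall j, (j < N)%N -> P j L.
  by apply: uniform_coins => // j; have [] := scaled_run j.
have N0 : (0 < N)%N by rewrite ltn_up_log2 addn2.
(* A always answers with a feasible solution, so one exists and the optimum is attained. *)
have [F0 hF0] : exists F, feasible phi I F.
  have [h _] := PL 0 N0; have [|F _ hF] := h (nseq L false);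
    first by rewrite size_nseq.
  by exists F.
have [ov ho] : exists ov, is_opt phi I ov.
  have ex : exists m, `[< exists2 F, feasible phi I F & cost I F = m >].
    by exists (cost I F0); apply/asboolP; exists F0.
  exists (ex_minn ex); case: ex_minnP => m /asboolP hm hmin; split=> // F hF.
  by apply: hmin; apply/asboolP; exists F.
have ovle : (ov <= n * maxw I)%N.
  apply: leq_trans (_ : (cost I F0 <= _)%N); first by case: ho => _; apply.
  by apply: (sum_weight_le vI);
    [exact: fset_uniq | by have /fsubsetP := phi_wf _ _ _ hF0].
(* The right guess is the largest power of two not above the optimum; for optimum 0 any guess does,
   and the first is taken. *)
have [j0 j0N hj0] : exists2 j,
  (j < N)%N & ov = 0%N \/ (2 ^ j <= ov < 2 * 2 ^ j)%N.
  have [->|ov0] := posnP ov; first by exists 0 => //; left.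
  have /= /andP[b1 b2] := trunc_log_bounds (isT : (1 < 2)%N) ov0.
  exists (trunc_log 2 ov); last by right; rewrite b1 -expnS.
  by rewrite ltn_up_log2; lia.
pose Good m := (m%:R <= (1 + 3 * eps) * ov%:R :> rat).
have Good_le m m' : (m <= m')%N -> Good m' -> Good m.
  by move=> mm'; apply: le_trans; rewrite ler_nat.
set t' := (c0 * (N * (t + n + 1)))%N.
set B := ((M + t') ^ (6 * c + 6))%N.
have tt' : (t <= t')%N.
  rewrite /t' /c0; apply: leq_trans (_ : (t + n + 1 <= _)%N); first by lia.
  by apply: leq_trans (leq_pmull _ N0) _; apply: leq_pmull; lia.
have [_ _ M2] := input_lt_magnitude I eps; rewrite -/M in M2.
have fits : words_fit I eps B t by apply: words_fit_pow; rewrite -/M; lia.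
have BAB : (BA <= B)%N.
  rewrite /BA /B expnD expnM; apply: leq_trans (leq_pmulr _ _);
    last by rewrite expn_gt0; lia.
  have [->|cp] := posnP c; first by rewrite !expn0.
  rewrite leq_exp2r //; set Z := (M + t')%N.
  have MM : (M * M <= Z * Z)%N by apply: leq_mul; lia.
  have ZZ : (Z <= Z * Z)%N by rewrite leq_pmull //; lia.
  apply: (@leq_trans (16 * (Z * Z))%N); first by lia.
  rewrite (expnD Z 4 2) leq_mul //.
  by rewrite -[16%N]/(2 ^ 4)%N leq_exp2r //; lia.
have sure j : (j < N)%N -> answers phi I eps A BA t Good false (2 ^ j) L.
  move=> /PL [h _]; apply: on_coins_le h => r _ [F hr hF].
  by exists F.
have once : true -> (j0 < N)%N /\ answers phi I eps A BA t Good true (2 ^ j0) L.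
  move=> _; split=> //; have [_ h] := PL _ j0N;
    apply: on_coins_le h => r _ [F hr hF].
  exists F => //; split; first by case: hF.
  by move=> _; apply: (scaled_approx phi_wf vI e01 _ ho hj0 hF);
    rewrite expn_gt0.
have hT := scaling_time_le I A t.
exists t', (N * L)%N; split.
- exact: scaling_time_bound.
- move=> r; have := runs_scaling phi_wf vI fits BAB Good_le sure (b :=
    false) (k := 0).
  move=> /(_ (fun h => False_ind _ (notF h)) r (size_tuple r)).
  move=> [bs [rest [u [st [e1 e2 e3 [F [f1 f2 _]]]]]]].
  exists F => //; exists (out st) => //; exists bs, rest, u, st; split=> //.
  exact: leq_trans e2 hT.
- pose E r := exists2 F,
    exists2 o, outputs B (input_of I eps) (scaling_prog A) t' r o & encodes o F
      &
    approx_solution phi I (3 * eps) F.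
  rewrite (half_le_Pr (N * L) E).
  have := runs_scaling phi_wf vI fits BAB Good_le sure once.
  apply: (@on_coins_le true) =>
    r _ [bs [rest [u [st [e1 e2 e3 [F [f1 f2 f3]]]]]]].
  exists F; last by split=> //; exists ov => //; exact: f3.
  exists (out st) => //; exists bs, rest, u, st; split=> //.
  exact: leq_trans e2 hT.
Qed.
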